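(* Let $\{(X_t,v_t):t\ge0\}$ be the telegrapher's process with drift $TP_E(\lambda,\kappa,\gamma)$ defined in the context, started from $X_0=0$ with initial velocity uniformly distributed on $\{-1,1\}$. Its large deviation free energy function is $$F_E(\alpha)=\lim_{t\to\infty}\frac1t\log\mathbb{E}\,e^{\alpha X_t}=\alpha^2\kappa+2\alpha\kappa E+\sqrt{\lambda^2\alpha^2+\gamma^2}-\gamma .$$ The asymptotic velocity of the particle is $$\lim_{t\to\infty}\frac1t\mathbb{E}(X_t)=F_E'(0)=2\kappa E .$$ The limiting diffusion constant does not depend on $E$ and equals $$\lim_{t\to\infty}\frac1t\mathrm{Var}(X_t)=F_E''(0)=2\kappa+\frac{\lambda^2}{\gamma}.$$ As a consequence, the Einstein relation, relating the limiting velocity and the diffusion constant, is violated as soon as $\lambda\neq0$, and the correction due to the activity is of order $\lambda^2$.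
   Context: $TP_E(\lambda,\kappa,\gamma)$ is the process on $\mathbb{R}\times\{-1,1\}$ (position and velocity) whose probability density $\mu(x,t,v)$ to find the particle at time $t$ at position $x$ with velocity $v$ satisfies the Kolmogorov forward equation $$\partial_t\mu(x,t,v)=-\lambda v\,\partial_x\mu(x,t,v)-2\kappa E\,\partial_x\mu(x,t,v)+\kappa\,\partial_x^2\mu(x,t,v)+\gamma\big(\mu(x,t,-v)-\mu(x,t,v)\big).$$ Here $E$ is the external field (a constant), $\lambda$ is the strength of the drift in the direction of the velocity $v$, the additional Brownian noise has variance $2\kappa t$ at time $t$, and the velocity flips $v\to-v$ according to a Poisson process with rate $\gamma$. The symbol $\mathbb{E}$ denotes expectation and $\mathrm{Var}$ variance. *)

(* Defs.v *)
From mathcomp Require Import all_boot all_order all_algebra.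
From mathcomp Require Import all_classical all_reals all_analysis.

Set Implicit Arguments.
Unset Strict Implicit.
Unset Printing Implicit Defensive.

Import Order.TTheory GRing.Theory Num.Theory.
Import numFieldNormedType.Exports.

Local Open Scope ring_scope.
Local Open Scope classical_set_scope.

Section Telegrapher.
Context {R : realType}.
Implicit Types (mu : R -> R -> R -> R) (lambda kappa gamma E v : R).

(* Densities are written mu x t v, with the velocity v ranging over the two
   reals 1 and -1. *)
Definition is_velocity v : Prop := v = 1 \/ v = -1.

Definition dt mu x t v : R := derive1 (fun s => mu x s v) t.
Definition dx mu x t v : R := derive1 (fun y => mu y t v) x.
Definition dxx mu x t v : R := derive1 (fun y => dx mu y t v) x.

(* Regularity C^{1,2} on R x ]0, +oo[; the derivability clauses are needed
   because derive1 is total. *)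
Definition regular_density mu : Prop :=
  forall v, is_velocity v -> forall x t : R, 0 < t ->
  [/\ derivable (fun s => mu x s v) t 1,
      derivable (fun y => mu y t v) x 1,
      derivable (fun y => dx mu y t v) x 1 &
      [/\ {for (x, t), continuous (fun p : R * R => mu p.1 p.2 v)},
          {for (x, t), continuous (fun p : R * R => dt mu p.1 p.2 v)},
          {for (x, t), continuous (fun p : R * R => dx mu p.1 p.2 v)} &
          {for (x, t), continuous (fun p : R * R => dxx mu p.1 p.2 v)}]].

Definition forward_equation lambda kappa gamma E mu : Prop :=
  forall v, is_velocity v -> forall x t : R, 0 < t ->
  dt mu x t v = - (lambda * v * dx mu x t v)
                - 2 * kappa * E * dx mu x t v
                + kappa * dxx mu x t v
                + gamma * (mu x t (- v) - mu x t v).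

(* mu(x, 0, v) = delta_0(x) / 2: a Dirac mass is not a density, so the initial
   datum is taken in the sense of weak convergence as t decreases to 0. *)
Definition initial_datum mu : Prop :=
  forall v, is_velocity v ->
  forall f : R -> R, continuous f -> (exists M : R, forall x : R, `|f x| <= M) ->
  (\int[lebesgue_measure]_x (f x * mu x t v)%:E)%E @[t --> 0^'+]
    --> (f 0 / 2)%:E.

(* Position and velocity are indexed by all real times, but only the times
   t >= 0 are constrained. At t = 0 the law has no density, hence 0 < t in
   tp_density. Only the one-time laws are prescribed. *)
Record telegrapher lambda kappa gamma E := Telegrapher {
  tp_disp : measure_display;
  tp_space : measurableType tp_disp;
  tp_prob : probability tp_space R;
  tp_X : R -> {RV tp_prob >-> R};
  tp_v : R -> {RV tp_prob >-> R};
  tp_velocity : forall (t : R) w, 0 <= t -> is_velocity (tp_v t w);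
  tp_start_X : tp_prob [set w | tp_X 0 w = 0] = 1%E;
  tp_start_v : forall v, is_velocity v ->
    tp_prob [set w | tp_v 0 w = v] = (2^-1)%:E;
  tp_mu : R -> R -> R -> R;
  tp_mu_ge0 : forall x t v : R, 0 < t -> is_velocity v -> 0 <= tp_mu x t v;
  tp_density : forall t v : R, 0 < t -> is_velocity v ->
    forall A : set R, measurable A ->
    tp_prob [set w | A (tp_X t w) /\ tp_v t w = v] =
      (\int[lebesgue_measure]_(x in A) (tp_mu x t v)%:E)%E;
  tp_regular : regular_density tp_mu;
  tp_forward : forward_equation lambda kappa gamma E tp_mu;
  tp_initial : initial_datum tp_mu
}.

Variables lambda kappa gamma E : R.
Implicit Type Z : telegrapher lambda kappa gamma E.

Definition log_mgf_rate Z (a : R) (t : R) : \bar R :=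
  ((t^-1)%:E * lne ('M_(tp_prob Z) (tp_X Z t) a))%E.
Definition mean_rate Z (t : R) : \bar R :=
  ((t^-1)%:E * 'E_(tp_prob Z)[tp_X Z t])%E.
Definition variance_rate Z (t : R) : \bar R :=
  ((t^-1)%:E * 'V_(tp_prob Z)[tp_X Z t])%E.

(* lim and fine are total: these three are meaningful only together with the
   convergence to a finite limit. *)
Definition free_energy Z (a : R) : R :=
  fine (lim (log_mgf_rate Z a t @[t --> +oo])).
Definition asymptotic_velocity Z : R :=
  fine (lim (mean_rate Z t @[t --> +oo])).
Definition diffusion_constant Z : R :=
  fine (lim (variance_rate Z t @[t --> +oo])).

End Telegrapher.

(* V and D give the asymptotic velocity and the diffusion constant as functions
   of the field. Since the field enters through the drift 2 kappa E while the
   noise has variance 2 kappa t, the relation is normalized as V(E) ~ D(0) E: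
   the mobility V'(0) is the diffusion constant. *)
Definition einstein_relation (R : realType) (V D : R -> R) : Prop :=
  derivable V 0 1 /\ derive1 V 0 = D 0.

(* Main.v *)
Require Import Defs.
From mathcomp Require Import all_boot all_order all_algebra.
From mathcomp Require Import all_classical all_reals all_analysis.
From mathcomp Require Import measurable_realfun.
From mathcomp Require Import ring lra.

Import Order.TTheory GRing.Theory Num.Theory.
Import numFieldNormedType.Exports.

Local Open Scope ring_scope.
Local Open Scope classical_set_scope.

(** Let L be the generator of the process,
      (L phi)(x, v) = kappa phi_xx + (lambda v + 2 kappa E) phi_x
                      + gamma (phi(x, -v) - phi(x, v)).
    The forward equation is the adjoint of L, so if phi_t + L phi = 0 then the
    integral of phi(., t, .) against the law at time t does not depend on t.
    Letting t decrease to 0 gives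
      E f(X_T) = (phi(0, 0, 1) + phi(0, 0, -1)) / 2   when phi(., T, .) = f
    ([backward_duality], [expectation_backward]). Everything else is an explicit
    solution of the backward equation:
    - for f = exp(a x) it is a linear system in the two velocities with
      constant coefficients, with eigenvalues
      kappa a^2 + 2 kappa E a - gamma +- s, where s^2 = lambda^2 a^2 + gamma^2.
      Hence E exp(a X_T) is a mixture of two exponentials in T
      ([mgf_telegrapher]), and the larger eigenvalue is the free energy;
    - for f = x and f = (x - 2 kappa E T)^2 there are solutions polynomial
      in x, which give the mean and the variance at every time
      ([mean_telegrapher], [variance_telegrapher]).

    The analytic point is that all one knows about the density is that it is
    smooth, nonnegative and of total mass 1; neither the integrability of
    exp(a x) nor an integration by parts over the whole line comes for free.
    So phi is multiplied by the cutoff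
    (1 - (x/r)^2)^2 on [-r, r]. It vanishes to second order at -r and r, which
    kills the boundary terms of the integration by parts, and its derivatives
    are O(1/r). If W dominates phi and phi_x, the truncated pairing therefore
    changes in time at a rate O(1/r) times the integral of W against the law
    ([cutoff_mean_le]). This is used twice. First W is a constant, so that unit
    mass suffices, and phi is the bounded supersolution
    exp(-C t) / (exp(-a x) + eps); this bounds all exponential moments
    ([exp_moment_segment]). Then W is exponential or quadratic, r tends to
    infinity, and duality becomes an equality. *)

Section Telegraph.
Set Implicit Arguments.
Unset Strict Implicit.
Unset Printing Implicit Defensive.

(** * Calculus on the line *)

Section Continuity.
Context {R : realType} {T : topologicalType}.
Implicit Types (f g : T -> R) (x : T).

Lemma continuous_pointwise f : (forall x, {for x, continuous f}) -> continuous f.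
Proof. by []. Qed.

Lemma continuous1_cst (k : R) x : {for x, continuous (fun=> k)}.
Proof. exact: cvg_cst. Qed.

Lemma continuous1_add f g x : {for x, continuous f} -> {for x, continuous g} ->
  {for x, continuous (fun y => f y + g y)}.
Proof. exact: cvgD. Qed.

Lemma continuous1_opp f x : {for x, continuous f} -> {for x, continuous (fun y => - f y)}.
Proof. exact: cvgN. Qed.

Lemma continuous1_mul f g x : {for x, continuous f} -> {for x, continuous g} ->
  {for x, continuous (fun y => f y * g y)}.
Proof. exact: cvgM. Qed.

Lemma continuous1_sqr f x : {for x, continuous f} -> {for x, continuous (fun y => f y ^+ 2)}.
Proof. by move=> cf; exact: continuous1_mul. Qed.

Lemma continuous1_expR f x : {for x, continuous f} ->
  {for x, continuous (fun y => expR (f y))}.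
Proof. by move=> cf; apply: continuous_comp => //; exact: continuous_expR. Qed.

Lemma continuous1_norm f x : {for x, continuous f} ->
  {for x, continuous (fun y => `|f y|)}.
Proof. by move=> cf; apply: continuous_comp => //; exact: norm_continuous. Qed.

End Continuity.

Lemma continuous1_id {R : realType} (x : R) : {for x, continuous (fun y : R => y)}.
Proof. by []. Qed.

Lemma continuous1_fst {R : realType} (p : R * R) :
  {for p, continuous (fun p : R * R => p.1)}.
Proof. exact: cvg_fst. Qed.

Lemma continuous1_snd {R : realType} (p : R * R) :
  {for p, continuous (fun p : R * R => p.2)}.
Proof. exact: cvg_snd. Qed.

(** Dispatch on the syntactic shape of the function: unification alone confuses
    a product with a square or a constant. *)
Ltac continuous_rules := lazymatch goal with |- prop_for _ (inPhantom (continuous ?F)) =>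
  lazymatch F with
  | fun y => y => exact (@continuous1_id _ _)
  | fun y => fst y => exact (@continuous1_fst _ _)
  | fun y => snd y => exact (@continuous1_snd _ _)
  | fun y => GRing.add (@?f y) (@?g y) => notypeclasses refine (@continuous1_add _ _ f g _ _ _)
  | fun y => GRing.opp (@?f y) => notypeclasses refine (@continuous1_opp _ _ f _ _)
  | fun y => GRing.mul (@?f y) (@?g y) => notypeclasses refine (@continuous1_mul _ _ f g _ _ _)
  | fun y => GRing.exp (@?f y) 2%N => notypeclasses refine (@continuous1_sqr _ _ f _ _)
  | fun y => expR (@?f y) => notypeclasses refine (@continuous1_expR _ _ f _ _)
  | fun y => Num.Def.normr (@?f y) => notypeclasses refine (@continuous1_norm _ _ f _ _)
  | _ => exact (@continuous1_cst _ _ _ _)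
  end end.

Section Calculus.
Context {R : realType}.
Implicit Types (f g : R -> R) (x a b c d s t u w M : R).
Local Notation leb := (@lebesgue_measure R).

Lemma is_derive1_cst (k x : R) : is_derive x 1 (fun=> k) 0.
Proof. exact: is_derive_cst. Qed.

Lemma is_derive1_id x : is_derive x 1 (fun y : R => y) 1.
Proof. exact: is_derive_id. Qed.

Lemma is_derive1_add f g df dg x : is_derive x 1 f df -> is_derive x 1 g dg ->
  is_derive x 1 (fun y => f y + g y) (df + dg).
Proof. exact: is_deriveD. Qed.

Lemma is_derive1_opp f df x : is_derive x 1 f df ->
  is_derive x 1 (fun y => - f y) (- df).
Proof. exact: is_deriveN. Qed.

Lemma is_derive1_mul f g df dg x : is_derive x 1 f df -> is_derive x 1 g dg ->
  is_derive x 1 (fun y => f y * g y) (f x * dg + df * g x).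
Proof.
move=> hf hg; have H := is_deriveM hf hg; eapply is_derive_eq; first exact: H.
by rewrite [df * _]mulrC.
Qed.

Lemma is_derive1_sqr f df x : is_derive x 1 f df ->
  is_derive x 1 (fun y => f y ^+ 2) (2 * f x * df).
Proof.
move=> hf; have H := is_derive1_mul hf hf; eapply is_derive_eq; first exact: H.
by ring.
Qed.

Lemma is_derive1_inv f df x : f x != 0 -> is_derive x 1 f df ->
  is_derive x 1 (fun y => (f y)^-1) (- (f x) ^- 2 * df).
Proof. by move=> fx hf; exact: is_deriveV. Qed.

Lemma is_derive1_expR f df x : is_derive x 1 f df ->
  is_derive x 1 (fun y => expR (f y)) (expR (f x) * df).
Proof. by move=> hf; apply: (@is_derive1_comp _ expR f). Qed.

Lemma is_derive_continuous f df x : is_derive x 1 f df -> {for x, continuous f}.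
Proof. by move=> [h _]; apply/differentiable_continuous/derivable1_diffP. Qed.

Lemma integrable_segment f a b : continuous f ->
  leb.-integrable `[a, b] (EFin \o f).
Proof.
move=> cf; apply: continuous_compact_integrable; first exact: segment_compact.
exact: continuous_subspaceT.
Qed.

Lemma integral_derivative G g a b : a < b -> (forall x, is_derive x 1 G (g x)) ->
  continuous g -> \int[leb]_(x in `[a, b]) g x = G b - G a.
Proof.
move=> ab hG cg; have cG x : {for x, continuous G} := is_derive_continuous (hG x).
rewrite /Rintegral (@continuous_FTC2 _ g G)//.
- exact: continuous_subspaceT.
- split; first by move=> x _; case: (hG x).
  + exact/cvg_at_right_filter/cG.
  + exact/cvg_at_left_filter/cG.
- by move=> x _; rewrite derive1E; case: (hG x).
Qed.

Lemma Rintegral_segment_le f a b M : continuous f -> (forall x, 0 <= f x) ->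
  (\int[leb]_x (f x)%:E <= M%:E)%E -> \int[leb]_(x in `[a, b]) f x <= M.
Proof.
move=> cf f0 fM; rewrite -lee_fin /Rintegral fineK; last first.
  by apply: integrable_fin_num => //; exact: integrable_segment.
apply: le_trans fM; apply: ge0_subset_integral => //.
- by apply/measurable_EFinP; exact: continuous_measurable_fun.
- by move=> x _; rewrite lee_fin.
Qed.

Lemma Rintegral_subset f a b c d : continuous f -> (forall x, 0 <= f x) ->
  c <= a -> b <= d ->
  \int[leb]_(x in `[a, b]) f x <= \int[leb]_(x in `[c, d]) f x.
Proof.
move=> cf f0 ca bd; rewrite /Rintegral fine_le//.
- by apply: integrable_fin_num => //; exact: integrable_segment.
- by apply: integrable_fin_num => //; exact: integrable_segment.
apply: ge0_subset_integral => //.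
- apply/measurable_EFinP; apply: measurable_funTS; exact: continuous_measurable_fun.
- by move=> x _; rewrite lee_fin.
- by move=> x; rewrite /= !in_itv/= => /andP[ax xb]; apply/andP; split; lra.
Qed.

(** Monotone convergence along the segments [-n, n]. *)
Lemma integrable_of_segments f M : continuous f -> (forall x, 0 <= f x) ->
    (forall r : R, 0 < r -> \int[leb]_(x in `[- r, r]) f x <= M) ->
  leb.-integrable setT (EFin \o f).
Proof.
move=> cf f0 fM; apply/integrableP; split.
  by apply/measurable_EFinP; exact: continuous_measurable_fun.
pose F n : set R := `[- n.+1%:R, n.+1%:R].
have FT : \bigcup_n F n = setT.
  apply/seteqP; split=> // x _; exists (Num.truncn `|x|) => //.
  by rewrite /F /= in_itv/= -ler_norml ltW// truncnS_gt.
have ndF : nondecreasing_seq F.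
  move=> m n mn; apply/subsetPset => x; rewrite /F /= !in_itv/= -!ler_norml.
  by move=> /le_trans; apply; rewrite ler_nat ltnS.
have mF n : measurable (F n : set (measurableTypeR R)) by exact: measurable_itv.
have mf n : measurable_fun (F n) (EFin \o f).
  by apply/measurable_EFinP; apply: measurable_funTS; exact: continuous_measurable_fun.
have f0' n x : F n x -> (0 <= (EFin \o f) x)%E by rewrite lee_fin.
under eq_integral do rewrite gee0_abs ?lee_fin//.
have := @ge0_nondecreasing_set_cvg_integral _ (measurableTypeR R) _ F (EFin \o f) leb ndF mF mf f0'.
rewrite FT => cv; apply: (@le_lt_trans _ _ M%:E); last exact: ltry.
rewrite -(cvg_lim _ cv)//; apply: lime_le; first by apply/cvg_ex; eexists; exact: cv.
near=> n; have := fM n.+1%:R (ltr0Sn _ _); rewrite -lee_fin /Rintegral fineK//.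
by apply: integrable_fin_num => //; exact: integrable_segment.
Unshelve. all: by end_near. Qed.

Lemma bounded_rectangle (h : R -> R -> R) a b c d :
  (forall x t, c <= t <= d -> {for (x, t), continuous (fun p => h p.1 p.2)}) ->
  exists2 M : R, 0 <= M & forall x t, a <= x <= b -> c <= t <= d -> `|h x t| <= M.
Proof.
move=> ch; pose A := (`[a, b] `*` `[c, d] : set (R * R)).
have cA : compact A by apply: compact_setX; exact: segment_compact.
have cf : {within A, continuous (fun p : R * R => h p.1 p.2 : R^o)}.
  apply: continuous_in_subspaceT => -[x t]; rewrite inE => -[/= _].
  by rewrite in_itv/=; exact: ch.
have /compact_bounded[M [_ hM]] := continuous_compact cf cA.
exists (`|M| + 1); first by rewrite addr_ge0.
move=> x t hx ht; apply: (hM (`|M| + 1)).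
  by rewrite (le_lt_trans (ler_norm M))// ltrDl.
by exists (x, t) => //; split; rewrite /= in_itv.
Qed.

(** On a rectangle a continuous time derivative is bounded, and this constant
    is the dominating function required to differentiate under the integral. *)
Lemma is_derive_integral (h dh : R -> R -> R) a b u t w :
  u < t < w ->
  (forall s, u <= s <= w -> continuous (h ^~ s)) ->
  (forall x s, u <= s <= w -> is_derive s 1 (h x) (dh x s)) ->
  (forall x s, u <= s <= w -> {for (x, s), continuous (fun p => dh p.1 p.2)}) ->
  is_derive t 1 (fun s => \int[leb]_(x in `[a, b]) h x s)
    (\int[leb]_(x in `[a, b]) dh x t).
Proof.
move=> utw ch hd cd.
have [M M0 hM] := @bounded_rectangle dh a b u w cd.
have uw s : (`]u, w[ : set R) s -> u <= s <= w.
  by rewrite /= in_itv/= => /andP[/ltW-> /ltW->].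
have tI : (`]u, w[ : set R) t by rewrite /= in_itv/=.
have int s : (`]u, w[ : set R) s -> leb.-integrable `[a, b] (EFin \o (h ^~ s)).
  by move=> /uw /ch; exact: integrable_segment.
have der s y : (`]u, w[ : set R) s -> (`[a, b] : set R) y ->
    derivable ((fun s x => h x s) ^~ y) s 1.
  by move=> /uw hs _; case: (hd y s hs).
have dE s y : u <= s <= w -> partial1of2 (fun s x => h x s) s y = dh y s.
  by move=> hs; rewrite partial1of2E; case: (hd y s hs).
have intM : leb.-integrable `[a, b] (EFin \o cst M).
  by apply: integrable_segment => x; exact: cvg_cst.
have bnd s y : (`]u, w[ : set R) s -> (`[a, b] : set R) y ->
    `|partial1of2 (fun s x => h x s) s y| <= M.
  by move=> /uw hs hy; rewrite dE//; apply: hM.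
have M0' (y : R) : 0 <= cst M y by [].
have mI : measurable (`[a, b] : set (measurableTypeR R)) by [].
have D := derivable_under_integral mI tI int der M0' intM bnd.
have DI := differentiation_under_integral mI tI int der M0' intM bnd.
apply: DeriveDef => //; rewrite -derive1E DI.
by apply: eq_Rintegral => y _; rewrite dE//; exact: uw.
Qed.

End Calculus.

(** [notypeclasses refine] keeps instance resolution from unfolding the atoms
    before a dedicated rule can be applied to them. *)
Ltac derive_rules := first
  [ notypeclasses refine (is_derive1_cst _ _) | notypeclasses refine (is_derive1_id _)
  | notypeclasses refine (is_derive1_sqr _) | notypeclasses refine (is_derive1_add _ _)
  | notypeclasses refine (is_derive1_opp _) | notypeclasses refine (is_derive1_mul _ _)
  | notypeclasses refine (is_derive1_expR _) ].

(** * A polynomial cutoff *)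

Section Cutoff.
Context {R : realType}.
Implicit Types (r x : R).

(** Only its values on [-r, r] matter. As a polynomial it needs no gluing, and
    the square makes both it and its derivative vanish at -r and r. *)
Definition cutoff r x : R := (1 - (x / r) ^+ 2) ^+ 2.
Definition cutoff1 r x : R := - (4 / r * (x / r) * (1 - (x / r) ^+ 2)).
Definition cutoff2 r x : R := (12 * (x / r) ^+ 2 - 4) / r ^+ 2.

Lemma is_derive_cutoff r x : is_derive x 1 (cutoff r) (cutoff1 r x).
Proof.
rewrite /cutoff; eapply is_derive_eq; first by do ?derive_rules.
by rewrite /cutoff1 /=; ring.
Qed.

Lemma is_derive_cutoff1 r x : is_derive x 1 (cutoff1 r) (cutoff2 r x).
Proof.
rewrite /cutoff1; eapply is_derive_eq; first by do ?derive_rules.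
by rewrite /cutoff2 -exprVn /=; ring.
Qed.

Lemma continuous_cutoff2 r : continuous (cutoff2 r).
Proof. by apply: continuous_pointwise => x; rewrite /cutoff2; do ?continuous_rules. Qed.

Lemma cutoff_ge0 r x : 0 <= cutoff r x.
Proof. exact: sqr_ge0. Qed.

Lemma cutoff_edge r x : 0 < r -> x ^+ 2 = r ^+ 2 -> cutoff r x = 0 /\ cutoff1 r x = 0.
Proof.
move=> r0 xr; have r20 : r ^+ 2 != 0 by rewrite sqrf_eq0 gt_eqF.
have u1 : (x / r) ^+ 2 = 1 by rewrite expr_div_n xr divff.
by rewrite /cutoff /cutoff1 u1 subrr expr0n mulr0 oppr0.
Qed.

Lemma div_norm_le1 r x : 0 < r -> - r <= x <= r -> 0 <= (x / r) ^+ 2 <= 1.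
Proof.
move=> r0 /andP[x1 x2].
have : - 1 <= x / r by rewrite ler_pdivlMr// mulN1r.
have : x / r <= 1 by rewrite ler_pdivrMr// mul1r.
by move=> *; apply/andP; split; nra.
Qed.

Lemma cutoff_le1 r x : 0 < r -> - r <= x <= r -> cutoff r x <= 1.
Proof.
by move=> r0 xr; have := div_norm_le1 r0 xr; rewrite /cutoff => /andP[]; nra.
Qed.

(** With r >= 1 the bound 8/r^2 on the second derivative is weakened to 8/r, so
    that all the errors have the same order. *)
Lemma cutoff_bounds r x : 1 <= r -> - r <= x <= r ->
  `|cutoff1 r x| <= 4 / r /\ `|cutoff2 r x| <= 8 / r.
Proof.
move=> r1 xr; have r0 : 0 < r by lra.
have /andP[w0 w1] := div_norm_le1 r0 xr.
have u1 : `|x / r| <= 1 by rewrite -[leRHS]normr1 -ler_sqr ?nnegrE// -!normrX expr1n normr1 ger0_norm.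
rewrite /cutoff1 /cutoff2; move: (x / r) u1 w0 w1 => u u1.
have V0 : 0 < r^-1 by rewrite invr_gt0.
have V1 : r^-1 <= 1 by rewrite invf_le1.
rewrite -exprVn; move: r^-1 V0 V1 (u ^+ 2) => V V0 V1 w w0 w1.
split.
- rewrite normrN 2!normrM [`|4 * V|]ger0_norm ?[`|1 - w|]ger0_norm; [|lra|nra].
  rewrite -mulrA ler_piMr; [done| nra |].
  by have := normr_ge0 u; nra.
- rewrite normrM [`|V ^+ 2|]ger0_norm ?sqr_ge0//.
  have : `|12 * w - 4| <= 8 by rewrite ler_norml; apply/andP; split; lra.
  by have := normr_ge0 (12 * w - 4); nra.
Qed.

End Cutoff.

(** * Pairing a test function with the density on a segment *)

Section Duality.
Context {R : realType}.
Variables lambda kappa gamma E : R.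
Local Notation leb := (@lebesgue_measure R).
Implicit Types (mu phi : R -> R -> R -> R) (r s t u T x v K : R) (W : R -> R).

(** The analytic content of [telegrapher], without the probability space. *)
Record forward_density mu : Prop := ForwardDensity {
  fd_ge0 : forall x t v, 0 < t -> is_velocity v -> 0 <= mu x t v;
  fd_mass : forall t, 0 < t ->
    (\int[leb]_x (mu x t 1 + mu x t (-1))%:E = 1)%E;
  fd_regular : regular_density mu;
  fd_forward : forward_equation lambda kappa gamma E mu;
  fd_initial : initial_datum mu }.

(** The derivatives are carried explicitly. Joint continuity is required of
    phi and phi_t only, for the differentiation in time under the integral. *)
Record smooth_test phi phi_t phi_x phi_xx : Prop := SmoothTest {
  st_dt : forall x t v, is_derive t 1 (fun s => phi x s v) (phi_t x t v);
  st_dx : forall x t v, is_derive x 1 (fun y => phi y t v) (phi_x x t v);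
  st_dxx : forall x t v, is_derive x 1 (fun y => phi_x y t v) (phi_xx x t v);
  st_cont : forall v, continuous (fun p : R * R => phi p.1 p.2 v);
  st_cont_dt : forall v, continuous (fun p : R * R => phi_t p.1 p.2 v);
  st_cont_dxx : forall t v, continuous (fun x => phi_xx x t v) }.

Definition drift v : R := lambda * v + 2 * kappa * E.

(** phi_t + L phi, for the generator L of the process. *)
Definition backward_residual phi phi_t phi_x phi_xx x t v : R :=
  phi_t x t v + kappa * phi_xx x t v + drift v * phi_x x t v
  + gamma * (phi x t (- v) - phi x t v).

(** The terms of L (cutoff * phi) in which the cutoff is differentiated. *)
Definition cutoff_error r phi phi_x x t v : R :=
  kappa * (2 * cutoff1 r x * phi_x x t v + cutoff2 r x * phi x t v)
  + drift v * cutoff1 r x * phi x t v.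

Definition cutoff_mean r mu phi t : R :=
  \int[leb]_(x in `[- r, r])
     (cutoff r x * (phi x t 1 * mu x t 1 + phi x t (-1) * mu x t (-1))).

Lemma velocity1 : is_velocity (1 : R). Proof. by left. Qed.
Lemma velocityN1 : is_velocity (-1 : R). Proof. by right. Qed.

Lemma slice_continuous (h : R * R -> R) x t :
  {for (x, t), continuous h} -> {for x, continuous (fun y => h (y, t))}.
Proof.
move=> ch; apply: (@continuous_comp _ _ _ (fun y : R => (y, t)) h) => //.
move=> A [[B C] [/= nB nC] sA]; apply: (@filterS _ (nbhs x) _ B) nB => y By.
by apply: sA; split=> //=; exact: nbhs_singleton.
Qed.

Section Fixed.
Variables (mu phi phi_t phi_x phi_xx : R -> R -> R -> R).
Hypothesis fd : forward_density mu.
Hypothesis st : smooth_test phi phi_t phi_x phi_xx.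

Lemma density_dt x t v : 0 < t -> is_velocity v ->
  is_derive t 1 (fun s => mu x s v) (dt mu x t v).
Proof.
move=> t0 hv; have [H _ _ _] := fd_regular fd hv x t0.
exact (DeriveDef H (esym (derive1E (fun s => mu x s v) t))).
Qed.

Lemma density_dx x t v : 0 < t -> is_velocity v ->
  is_derive x 1 (fun y => mu y t v) (dx mu x t v).
Proof.
move=> t0 hv; have [_ H _ _] := fd_regular fd hv x t0.
exact (DeriveDef H (esym (derive1E (fun y => mu y t v) x))).
Qed.

Lemma density_dxx x t v : 0 < t -> is_velocity v ->
  is_derive x 1 (fun y => dx mu y t v) (dxx mu x t v).
Proof.
move=> t0 hv; have [_ _ H _] := fd_regular fd hv x t0.
exact (DeriveDef H (esym (derive1E (fun y => dx mu y t v) x))).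
Qed.

Lemma density_cont_dxx x t v : 0 < t -> is_velocity v ->
  {for x, continuous (fun y => dxx mu y t v)}.
Proof.
move=> t0 hv; have [_ _ _ [_ _ _ H]] := fd_regular fd hv x t0.
exact: (slice_continuous H).
Qed.

Lemma density_cont x t v : 0 < t -> is_velocity v ->
  {for x, continuous (fun y => mu y t v)}.
Proof. by move=> t0 hv; exact: is_derive_continuous (density_dx _ t0 hv). Qed.

Lemma density_cont_dx x t v : 0 < t -> is_velocity v ->
  {for x, continuous (fun y => dx mu y t v)}.
Proof. by move=> t0 hv; exact: is_derive_continuous (density_dxx _ t0 hv). Qed.

Lemma test_cont x t v : {for x, continuous (fun y => phi y t v)}.
Proof. exact: is_derive_continuous (st_dx st _ _ _). Qed.

Lemma test_cont_dx x t v : {for x, continuous (fun y => phi_x y t v)}.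
Proof. exact: is_derive_continuous (st_dxx st _ _ _). Qed.

Lemma test_cont_dt x t v : {for x, continuous (fun y => phi_t y t v)}.
Proof.
have H : {for (x, t), continuous (fun p : R * R => phi_t p.1 p.2 v)}.
  exact: (st_cont_dt st).
exact: (slice_continuous H).
Qed.

Lemma cutoff_cont r x : {for x, continuous (cutoff r)}.
Proof. exact: is_derive_continuous (is_derive_cutoff _ _). Qed.

Lemma cutoff_cont1 r x : {for x, continuous (cutoff1 r)}.
Proof. exact: is_derive_continuous (is_derive_cutoff1 _ _). Qed.

Ltac velocity := solve [exact velocity1 | exact velocityN1].

Ltac cont_leaf := lazymatch goal with |- prop_for _ (inPhantom (continuous ?F)) =>
  lazymatch F with
  | cutoff _ => exact (@cutoff_cont _ _)
  | cutoff1 _ => exact (@cutoff_cont1 _ _)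
  | cutoff2 _ => exact (@continuous_cutoff2 _ _ _)
  | fun y => cutoff _ y => exact (@cutoff_cont _ _)
  | fun y => cutoff1 _ y => exact (@cutoff_cont1 _ _)
  | fun y => cutoff2 _ y => exact (@continuous_cutoff2 _ _ _)
  | fun y => phi y _ _ => exact (@test_cont _ _ _)
  | fun y => phi_t y _ _ => exact (@test_cont_dt _ _ _)
  | fun y => phi_x y _ _ => exact (@test_cont_dx _ _ _)
  | fun y => phi_xx y _ _ => exact: (st_cont_dxx st)
  | fun y => mu y _ _ => refine (@density_cont _ _ _ _ _); [assumption | velocity]
  | fun y => dx mu y _ _ => refine (@density_cont_dx _ _ _ _ _); [assumption | velocity]
  | fun y => dxx mu y _ _ => refine (@density_cont_dxx _ _ _ _ _); [assumption | velocity]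
  end end.

Ltac cont := apply: continuous_pointwise => ?; repeat first [cont_leaf | continuous_rules].

(** The forward equation moves the time derivative of mu onto space derivatives,
    and two integrations by parts move those onto cutoff * phi. After
    summation over the velocities the flips of mu become flips of phi. *)
Lemma is_derive_cutoff_mean r t : 0 < r -> 0 < t ->
  is_derive t 1 (cutoff_mean r mu phi)
    (\int[leb]_(x in `[- r, r])
      (cutoff r x * (backward_residual phi phi_t phi_x phi_xx x t 1 * mu x t 1
                     + backward_residual phi phi_t phi_x phi_xx x t (-1) * mu x t (-1))
       + (cutoff_error r phi phi_x x t 1 * mu x t 1
          + cutoff_error r phi phi_x x t (-1) * mu x t (-1)))).
Proof.
move=> r0 t0.
pose dh x s := cutoff r x *
  ((phi x s 1 * dt mu x s 1 + phi_t x s 1 * mu x s 1) +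
   (phi x s (-1) * dt mu x s (-1) + phi_t x s (-1) * mu x s (-1))).
have half_gt0 s : t / 2 <= s <= t * 2 -> 0 < s by move=> /andP[+ _]; lra.
have D : is_derive t 1 (cutoff_mean r mu phi) (\int[leb]_(x in `[- r, r]) dh x t).
  apply: (@is_derive_integral _ (fun x s => cutoff r x *
      (phi x s 1 * mu x s 1 + phi x s (-1) * mu x s (-1))) dh _ _ (t / 2) t (t * 2)).
  - by apply/andP; split; lra.
  - by move=> s /half_gt0 s0; cont.
  - move=> x s /half_gt0 s0; rewrite /dh.
    eapply is_derive_eq.
      by repeat first [exact (st_dt st _ _ _) | exact (density_dt _ s0 velocity1)
        | exact (density_dt _ s0 velocityN1) | derive_rules].
    by rewrite /=; ring.
  - move=> x s /half_gt0 s0.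
    have [_ _ _ [c1 d1 _ _]] := fd_regular fd velocity1 x s0.
    have [_ _ _ [c2 d2 _ _]] := fd_regular fd velocityN1 x s0.
    have cc : {for (x, s), continuous (fun p : R * R => cutoff r p.1)}.
      apply: (@continuous_comp _ _ _ fst (cutoff r)); first exact: cvg_fst.
      exact: cutoff_cont.
    rewrite /dh.
    repeat lazymatch goal with
    | |- prop_for _ (inPhantom (continuous (fun p => cutoff r p.1))) => exact cc
    | |- prop_for _ (inPhantom (continuous (fun p => mu p.1 p.2 _))) =>
        first [exact c1 | exact c2]
    | |- prop_for _ (inPhantom (continuous (fun p => dt mu p.1 p.2 _))) =>
        first [exact d1 | exact d2]
    | |- prop_for _ (inPhantom (continuous (fun p => phi p.1 p.2 _))) =>
        exact: (st_cont st)
    | |- prop_for _ (inPhantom (continuous (fun p => phi_t p.1 p.2 _))) =>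
        exact: (st_cont_dt st)
    | _ => continuous_rules end.
apply: is_derive_eq D _.
(* [dflux] is the derivative of [flux], and exactly what has to be subtracted
   from the integrand; [flux] vanishes at both ends with the cutoff and its
   derivative, so the subtraction does not change the integral. *)
pose flux v x := kappa * (cutoff r x * phi x t v * dx mu x t v
    - (cutoff1 r x * phi x t v + cutoff r x * phi_x x t v) * mu x t v)
    - drift v * (cutoff r x * phi x t v * mu x t v).
pose dflux v x := kappa * (cutoff r x * phi x t v * dxx mu x t v
    - (cutoff2 r x * phi x t v + 2 * cutoff1 r x * phi_x x t v
       + cutoff r x * phi_xx x t v) * mu x t v)
    - drift v * ((cutoff1 r x * phi x t v + cutoff r x * phi_x x t v) * mu x t v
       + cutoff r x * phi x t v * dx mu x t v).
have DF v x : is_velocity v -> is_derive x 1 (flux v) (dflux v x).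
  move=> hv; eapply is_derive_eq.
    by repeat first [exact (is_derive_cutoff _ _) | exact (is_derive_cutoff1 _ _)
      | exact (st_dx st _ _ _) | exact (st_dxx st _ _ _)
      | exact (density_dx _ t0 hv) | exact (density_dxx _ t0 hv) | derive_rules].
  by rewrite /dflux /=; ring.
have I0 : \int[leb]_(x in `[- r, r]) (dflux 1 x + dflux (-1) x) = 0.
  have DF2 x : is_derive x 1 (fun x => flux 1 x + flux (-1) x)
      (dflux 1 x + dflux (-1) x).
    exact (is_derive1_add (DF _ x velocity1) (DF _ x velocityN1)).
  have c2 : continuous (fun x => dflux 1 x + dflux (-1) x).
    by rewrite /dflux; cont.
  have rr : - r < r by lra.
  rewrite (integral_derivative rr DF2 c2).
  have [c1 d1] := cutoff_edge r0 (erefl (r ^+ 2)).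
  have [c3 d3] := cutoff_edge r0 (sqrrN r).
  by rewrite /flux c1 d1 c3 d3; ring.
rewrite -[RHS]addr0 -[in RHS]I0 -RintegralD//; last 2 first.
- by apply: integrable_segment; rewrite /backward_residual /cutoff_error; cont.
- by apply: integrable_segment; rewrite /dflux; cont.
apply: eq_Rintegral => x _.
rewrite /dh (fd_forward fd velocity1 x t0) (fd_forward fd velocityN1 x t0).
rewrite /dflux /backward_residual /cutoff_error /drift opprK.
move: (mu x t 1) (mu x t (-1)) (dx mu x t 1) (dx mu x t (-1)).
move: (dxx mu x t 1) (dxx mu x t (-1)) (phi x t 1) (phi x t (-1)).
move: (phi_t x t 1) (phi_t x t (-1)) (phi_x x t 1) (phi_x x t (-1)).
move: (phi_xx x t 1) (phi_xx x t (-1)) (cutoff r x) (cutoff1 r x) (cutoff2 r x).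
by move=> *; ring.
Qed.

(** Collects the bounds 2 * 4/r + 8/r on the diffusive part of the cutoff error
    and 4/r on its drift part. *)
Definition cutoff_rate : R := 16 * kappa + 4 * (`|lambda| + `|2 * kappa * E|).

Lemma cutoff_error_le r x t v (w : R) : 0 <= kappa -> 1 <= r -> - r <= x <= r ->
  is_velocity v -> `|phi x t v| <= w -> `|phi_x x t v| <= w ->
  cutoff_error r phi phi_x x t v <= cutoff_rate / r * w.
Proof.
move=> kap0 r1 xr hv p1 p2; have [c1 c2] := cutoff_bounds r1 xr.
have r0 : 0 <= r^-1 by rewrite invr_ge0; lra.
have w0 : 0 <= w := le_trans (normr_ge0 _) p1.
have hd : `|drift v| <= `|lambda| + `|2 * kappa * E|.
  rewrite (le_trans (ler_normD _ _))// lerD2r normrM.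
  by case: hv => ->; rewrite ?normrN normr1 mulr1.
rewrite (le_trans (ler_norm _))// /cutoff_error /cutoff_rate.
move: (cutoff1 r x) (cutoff2 r x) c1 c2 => d1 d2 c1 c2.
move: (`|lambda| + `|2 * kappa * E|) hd => B hd.
rewrite (le_trans (ler_normD _ _))// (mulrDl (16 * kappa)) (mulrDl (16 * kappa / r)) lerD//.
  rewrite normrM (ger0_norm kap0) (mulrC 16) -!mulrA ler_wpM2l//.
  rewrite (le_trans (ler_normD _ _))// !normrM (ger0_norm (ler0n _ _)).
  have : `|d1| * `|phi_x x t v| <= 4 / r * w by exact: ler_pM.
  have : `|d2| * `|phi x t v| <= 8 / r * w by exact: ler_pM.
  lra.
rewrite 2!normrM (mulrC 4) -!mulrA; apply: ler_pM => //.
by rewrite mulrA; exact: ler_pM.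
Qed.

(** The residual of a subsolution has a sign, so only the cutoff error, of order
    1/r, can make the pairing grow; the mean value theorem integrates this. *)
Lemma cutoff_mean_slope W T K r s t : continuous W ->
    (forall x t v, 0 <= t <= T -> is_velocity v ->
       `|phi x t v| <= W x /\ `|phi_x x t v| <= W x) ->
    (forall r t, 0 < r -> 0 < t <= T ->
       \int[leb]_(x in `[- r, r]) (W x * (mu x t 1 + mu x t (-1))) <= K) ->
    (forall x t v, 0 < t <= T -> is_velocity v ->
       backward_residual phi phi_t phi_x phi_xx x t v <= 0) ->
    0 <= kappa -> 1 <= r -> 0 < s < t -> t <= T ->
  cutoff_mean r mu phi t - cutoff_mean r mu phi s <= cutoff_rate / r * K * (t - s).
Proof.
move=> cW dom bdW sub kap0 r1 /andP[s0 st_] tT; have r0 : 0 < r by lra.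
have D u : 0 < u -> _ := @is_derive_cutoff_mean r u r0.
have Du u (hu : u \in `]s, t[%R) := D u (lt_trans s0 (andP hu).1).
have cs : {within `[s, t], continuous (cutoff_mean r mu phi)}.
  apply: continuous_in_subspaceT => u; rewrite inE/= in_itv/= => /andP[su _].
  exact: is_derive_continuous (D _ (lt_le_trans s0 su)).
have [u + ->] := MVT st_ Du cs; rewrite in_itv/= => /andP[su ut].
have u0 : 0 < u by lra.
have uT : 0 < u <= T by apply/andP; split; lra.
apply: ler_wpM2r; first by lra.
have rate0 : 0 <= cutoff_rate / r.
  by rewrite divr_ge0 ?(ltW r0)// /cutoff_rate addr_ge0// mulr_ge0// addr_ge0.
apply: le_trans (ler_wpM2l rate0 (bdW r u r0 uT)).
rewrite -RintegralZl//; last first.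
  by apply: integrable_segment; cont; exact: cW.
apply: le_Rintegral => //.
- by apply: integrable_segment; rewrite /backward_residual /cutoff_error; cont.
- by apply: integrable_segment; cont; exact: cW.
move=> x; rewrite /= in_itv/= => xr.
have term v : is_velocity v ->
    cutoff r x * (backward_residual phi phi_t phi_x phi_xx x u v * mu x u v)
    + cutoff_error r phi phi_x x u v * mu x u v <= cutoff_rate / r * (W x * mu x u v).
  move=> hv; have m0 := fd_ge0 fd x u0 hv.
  have [p1 p2] : `|phi x u v| <= W x /\ `|phi_x x u v| <= W x.
    by apply: dom => //; lra.
  have e := cutoff_error_le kap0 r1 xr hv p1 p2.
  rewrite mulrA [leRHS]mulrA -[leRHS]add0r lerD//; last exact: ler_wpM2r.
  by rewrite mulr_le0_ge0// mulr_ge0_le0 ?cutoff_ge0// sub.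
have := lerD (term _ velocity1) (term _ velocityN1).
move: (backward_residual _ _ _ _ _ _ _) (backward_residual _ _ _ _ _ _ _) => b1 b2.
move: (cutoff_error _ _ _ _ _ _) (cutoff_error _ _ _ _ _ _) => e1 e2.
by lra.
Qed.

Lemma mass_segment r t : 0 < t ->
  \int[leb]_(x in `[- r, r]) (mu x t 1 + mu x t (-1)) <= 1.
Proof.
move=> t0; apply: Rintegral_segment_le; first by cont.
- by move=> x; rewrite addr_ge0// (fd_ge0 fd) //; velocity.
- by rewrite (fd_mass fd t0).
Qed.

(** The initial datum is tested against phi(., 0, v) times the cutoff extended
    by 0, which is the square of the positive part of 1 - (x/r)^2. *)
Lemma cutoff_initial v r : is_velocity v -> 0 < r ->
  \int[leb]_(x in `[- r, r]) (cutoff r x * phi x 0 v * mu x t v) @[t --> 0^'+]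
    --> phi 0 0 v / 2.
Proof.
move=> hv r0.
pose u x : R := 1 - (x / r) ^+ 2.
pose f x := ((u x + `|u x|) / 2) ^+ 2 * phi x 0 v.
have uE x : u x = 1 - (x / r) ^+ 2 by [].
have cu : continuous u by apply: continuous_pointwise => x; rewrite /u; repeat continuous_rules.
have cf : continuous f.
  apply: continuous_pointwise => x; rewrite /f.
  repeat lazymatch goal with
    | |- prop_for _ (inPhantom (continuous (fun y => u y))) => exact: cu
    | |- prop_for _ (inPhantom (continuous (fun y => phi y _ _))) => exact: test_cont
    | _ => continuous_rules end.
have uin x : - r <= x <= r -> 0 <= u x.
  by move=> xr; rewrite uE; have := div_norm_le1 r0 xr; lra.
have uout x : ~~ (- r <= x <= r) -> u x <= 0.
  rewrite negb_and -!ltNge uE => /orP[x1|x1].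
    have : x / r < - 1 by rewrite ltr_pdivrMr// mulN1r.
    by nra.
  have : 1 < x / r by rewrite ltr_pdivlMr// mul1r.
  by nra.
have fin x : - r <= x <= r -> f x = cutoff r x * phi x 0 v.
  move=> /uin u0; rewrite /f (ger0_norm u0) /cutoff -uE; congr (_ ^+ 2 * _).
  by field.
have fout x : ~~ (- r <= x <= r) -> f x = 0.
  by move=> /uout u0; rewrite /f (ler0_norm u0) subrr mul0r expr0n mul0r.
have cf2 x t : 0 <= t <= 0 -> {for (x, t), continuous (fun p : R * R => f p.1)}.
  move=> _; apply: (@continuous_comp _ _ _ fst f); first exact: cvg_fst.
  exact: cf.
have [M M0 hM] := @bounded_rectangle _ (fun x _ => f x) (- r) r 0 0 cf2.
have fb : exists M : R, forall x, `|f x| <= M.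
  exists M => x; have [xr|/fout->] := boolP (- r <= x <= r); last by rewrite normr0.
  by apply: (hM x 0 xr); rewrite lexx.
have := fd_initial fd hv cf fb.
have -> : f 0 / 2 = phi 0 0 v / 2.
  by rewrite fin /cutoff ?mul0r ?expr0n/= ?subr0 ?expr1n ?mul1r//; lra.
move=> /fine_cvg; apply: cvg_trans; apply: near_eq_cvg; near=> t => /=.
rewrite [in RHS]/Rintegral integral_mkcond; congr fine; apply: eq_integral => x _.
rewrite patchE; have [xr|xr] := boolP (- r <= x <= r).
  by rewrite mem_set/= ?in_itv//= fin.
by rewrite memNset/= ?in_itv/= ?fout ?mul0r//; apply/negP.
Unshelve. all: by end_near. Qed.

(** The weak initial condition concerns a fixed test function, here phi(., 0, .).
    On [-r, r] the test function at time t differs from it by O(t), and the mass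
    of the law is at most 1. *)
Lemma cutoff_mean_initial r : 0 < r ->
  cutoff_mean r mu phi t @[t --> 0^'+] --> (phi 0 0 1 + phi 0 0 (-1)) / 2.
Proof.
move=> r0.
pose Y0 t := \int[leb]_(x in `[- r, r]) (cutoff r x * phi x 0 1 * mu x t 1)
  + \int[leb]_(x in `[- r, r]) (cutoff r x * phi x 0 (-1) * mu x t (-1)).
have Y0l : Y0 t @[t --> 0^'+] --> (phi 0 0 1 + phi 0 0 (-1)) / 2.
  rewrite mulrDl; apply: cvgD; apply: cutoff_initial => //; velocity.
have dtb v : exists2 M : R, 0 <= M &
    forall x t, - r <= x <= r -> 0 <= t <= 1 -> `|phi_t x t v| <= M.
  by apply: bounded_rectangle => x t _; exact: (st_cont_dt st).
have [M1 M10 hM1] := dtb 1; have [M2 M20 hM2] := dtb (-1).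
pose M := M1 + M2.
have lip v x t : is_velocity v -> - r <= x <= r -> 0 < t <= 1 ->
    `|phi x t v - phi x 0 v| <= M * t.
  move=> hv xr /andP[t0 t1].
  have cs : {within `[0, t], continuous (fun s => phi x s v)}.
    apply: continuous_subspaceT => s; exact: is_derive_continuous (st_dt st _ _ _).
  have [s + ->] := MVT t0 (fun s _ => st_dt st x s v) cs.
  rewrite in_itv/= => /andP[s0 st'].
  rewrite subr0 normrM (gtr0_norm t0) ler_wpM2r ?(ltW t0)// /M.
  have s01 : 0 <= s <= 1 by apply/andP; split; lra.
  case: hv => ->; [have := hM1 x s xr s01|have := hM2 x s xr s01]; lra.
have diff : cutoff_mean r mu phi t - Y0 t @[t --> 0^'+] --> 0.
  apply: norm_cvg0; apply: (@squeeze_cvgr _ _ _ _ (cst 0) (fun t => M * t)).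
  - near=> t; have t0 : 0 < t by near: t; exact: nbhs_right_gt.
    have t1 : t <= 1 by near: t; apply: nbhs_right_le.
    rewrite normr_ge0/= /Y0 /cutoff_mean.
    rewrite -RintegralD//; [|by apply: integrable_segment; cont..].
    rewrite -RintegralB//; [|by apply: integrable_segment; cont..].
    apply: (le_trans (le_normr_Rintegral _ _)) => //.
      by apply: integrable_segment; cont.
    rewrite -[leRHS]mulr1; apply: le_trans (ler_wpM2l _ (mass_segment r t0)); last first.
      by rewrite mulr_ge0 ?addr_ge0// ltW.
    rewrite -RintegralZl//; last by apply: integrable_segment; cont.
    apply: le_Rintegral => //.
    + by apply: integrable_segment; cont.
    + by apply: integrable_segment; cont.
    move=> x; rewrite /= in_itv/= => xr.
    have c1 : cutoff r x <= 1 := cutoff_le1 r0 xr.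
    have term v : is_velocity v ->
        `|cutoff r x * ((phi x t v - phi x 0 v) * mu x t v)| <= M * t * mu x t v.
      move=> hv; have m0 := fd_ge0 fd x t0 hv.
      rewrite normrM (ger0_norm (cutoff_ge0 _ _)) normrM (ger0_norm m0).
      rewrite mulrA ler_wpM2r// -[leRHS]mul1r ler_pM ?cutoff_ge0//.
      by apply: lip => //; rewrite t0.
    rewrite [leRHS]mulrDr; apply: le_trans (lerD (term _ velocity1) (term _ velocityN1)).
    by apply: le_trans (ler_normD _ _); rewrite le_eqVlt; apply/orP; left; apply/eqP; congr `|_|; ring.
  - exact: cvg_cst.
  - have cM : {for (0 : R), continuous (fun t => M * t)} by repeat continuous_rules.
    by rewrite -[X in _ --> X](mulr0 M); exact: cvg_at_right_filter.
have sumE : cutoff_mean r mu phi = (fun t => Y0 t + (cutoff_mean r mu phi t - Y0 t)).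
  by apply/funext => t; rewrite addrC subrK.
by rewrite sumE -[X in _ --> X]addr0; exact: cvgD.
Unshelve. all: by end_near. Qed.

Lemma cutoff_mean_le W T K r t : continuous W ->
    (forall x t v, 0 <= t <= T -> is_velocity v ->
       `|phi x t v| <= W x /\ `|phi_x x t v| <= W x) ->
    (forall r t, 0 < r -> 0 < t <= T ->
       \int[leb]_(x in `[- r, r]) (W x * (mu x t 1 + mu x t (-1))) <= K) ->
    (forall x t v, 0 < t <= T -> is_velocity v ->
       backward_residual phi phi_t phi_x phi_xx x t v <= 0) ->
    0 <= kappa -> 0 <= K -> 1 <= r -> 0 < t <= T ->
  cutoff_mean r mu phi t <=
    (phi 0 0 1 + phi 0 0 (-1)) / 2 + cutoff_rate * K * T / r.
Proof.
move=> cW dom bdW sub kap0 K0 r1 /andP[t0 tT]; have r0 : 0 < r by lra.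
rewrite addrC -lerBlDl.
apply: (cvgr_to_ge (cutoff_mean_initial r0)); near=> s.
have s0 : 0 < s by near: s; exact: nbhs_right_gt.
have st' : s < t by near: s; exact: nbhs_right_lt.
have s0t : 0 < s < t by rewrite s0.
have := cutoff_mean_slope cW dom bdW sub kap0 r1 s0t tT.
have c0 : 0 <= cutoff_rate / r * K.
  by rewrite mulr_ge0// divr_ge0 ?(ltW r0)// /cutoff_rate addr_ge0// mulr_ge0// addr_ge0.
have : cutoff_rate / r * K * (t - s) <= cutoff_rate / r * K * T.
  by rewrite ler_wpM2l//; lra.
have -> : cutoff_rate * K * T / r = cutoff_rate / r * K * T by ring.
by lra.
Unshelve. all: by end_near. Qed.

End Fixed.
End Duality.

(** * Exponential moments and backward duality *)

Section Moments.
Context {R : realType}.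
Variables lambda kappa gamma E : R.
Hypothesis kappa_ge0 : 0 <= kappa.
Local Notation leb := (@lebesgue_measure R).
Local Notation backward := (backward_residual lambda kappa gamma E).
Local Notation cutoff_rate := (cutoff_rate lambda kappa E).
Implicit Types (a eps r s t u T x v K : R) (W : R -> R).

(** exp(a x) / (1 + eps exp(a x)): a bounded substitute for exp(a x) whose first
    two derivatives are still controlled by the function itself. *)
Definition capped_exp a eps x : R := (expR (- (a * x)) + eps)^-1.

Section CappedExp.
Variables (a eps : R).
Hypothesis eps_gt0 : 0 < eps.

Lemma capped_exp_den_gt0 x : 0 < expR (- (a * x)) + eps.
Proof. by rewrite addr_gt0 ?expR_gt0. Qed.

Lemma capped_exp_gt0 x : 0 < capped_exp a eps x.
Proof. by rewrite invr_gt0 capped_exp_den_gt0. Qed.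

Lemma capped_exp_le x : capped_exp a eps x <= eps^-1.
Proof. by rewrite lef_pV2 ?posrE ?capped_exp_den_gt0// lerDr expR_ge0. Qed.

(** This ratio h turns the derivatives of g = [capped_exp] into polynomials:
    g' = a h g and g'' = a^2 (2 h^2 - h) g. *)
Lemma capped_exp_ratio x : 0 <= expR (- (a * x)) * capped_exp a eps x <= 1.
Proof.
rewrite mulr_ge0 ?expR_ge0 ?(ltW (capped_exp_gt0 x))//=.
by rewrite ler_pdivrMr ?capped_exp_den_gt0// mul1r lerDl ltW.
Qed.

Lemma is_derive_capped_exp x :
  is_derive x 1 (capped_exp a eps) (a * (expR (- (a * x)) * capped_exp a eps x) * capped_exp a eps x).
Proof.
have d0 := lt0r_neq0 (capped_exp_den_gt0 x).
eapply is_derive_eq.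
  notypeclasses refine (@is_derive1_inv _ (fun y => expR (- (a * y)) + eps) _ _ d0 _).
  by repeat derive_rules.
by rewrite /capped_exp /= -exprVn; ring.
Qed.

Lemma is_derive_tame1 x :
  is_derive x 1 (fun x => a * (expR (- (a * x)) * capped_exp a eps x) * capped_exp a eps x)
   (a ^+ 2 * (2 * (expR (- (a * x)) * capped_exp a eps x) ^+ 2
              - expR (- (a * x)) * capped_exp a eps x) * capped_exp a eps x).
Proof.
eapply is_derive_eq; first by repeat first [exact (is_derive_capped_exp _) | derive_rules].
by rewrite /=; ring.
Qed.

Lemma continuous_capped_exp : continuous (capped_exp a eps).
Proof. by move=> x; exact: is_derive_continuous (is_derive_capped_exp x). Qed.

Definition capped_exp_rate : R := `|lambda * a| + `|2 * kappa * E * a| + kappa * a ^+ 2.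

Lemma capped_exp_smooth : smooth_test
  (fun x t _ => expR (- (capped_exp_rate * t)) * capped_exp a eps x)
  (fun x t _ => - capped_exp_rate * expR (- (capped_exp_rate * t)) * capped_exp a eps x)
  (fun x t _ => expR (- (capped_exp_rate * t))
     * (a * (expR (- (a * x)) * capped_exp a eps x) * capped_exp a eps x))
  (fun x t _ => expR (- (capped_exp_rate * t))
     * (a ^+ 2 * (2 * (expR (- (a * x)) * capped_exp a eps x) ^+ 2
              - expR (- (a * x)) * capped_exp a eps x) * capped_exp a eps x)).
Proof.
move: capped_exp_rate => C.
have cg (p : R * R) : {for p, continuous (fun p => capped_exp a eps p.1)}.
  apply: (@continuous_comp _ _ _ fst (capped_exp a eps)); first exact: cvg_fst.
  exact: continuous_capped_exp.
split.
- move=> x t v; eapply is_derive_eq; first by repeat derive_rules.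
  by rewrite /=; ring.
- move=> x t v; eapply is_derive_eq.
    by repeat first [exact (is_derive_capped_exp _) | derive_rules].
  by rewrite /=; ring.
- move=> x t v; eapply is_derive_eq.
    notypeclasses refine (is_derive1_mul (is_derive1_cst _ _) (is_derive_tame1 _)).
  by rewrite /=; ring.
- by move=> v; apply: continuous_pointwise => p; repeat first [exact: cg | continuous_rules].
- by move=> v; apply: continuous_pointwise => p; repeat first [exact: cg | continuous_rules].
- move=> t v; apply: continuous_pointwise => x.
  by repeat first [exact: continuous_capped_exp | continuous_rules].
Qed.

(** A supersolution, because L g <= [capped_exp_rate] * g by the bounds on h. *)
Lemma capped_exp_backward x t v : is_velocity v ->
  backward (fun x t _ => expR (- (capped_exp_rate * t)) * capped_exp a eps x)
  (fun x t _ => - capped_exp_rate * expR (- (capped_exp_rate * t)) * capped_exp a eps x)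
  (fun x t _ => expR (- (capped_exp_rate * t))
     * (a * (expR (- (a * x)) * capped_exp a eps x) * capped_exp a eps x))
  (fun x t _ => expR (- (capped_exp_rate * t))
     * (a ^+ 2 * (2 * (expR (- (a * x)) * capped_exp a eps x) ^+ 2
              - expR (- (a * x)) * capped_exp a eps x) * capped_exp a eps x)) x t v <= 0.
Proof.
move=> hv; rewrite /backward_residual /drift subrr mulr0 addr0.
have /andP[h0 h1] := capped_exp_ratio x; have g0 := capped_exp_gt0 x.
move: (expR (- (a * x)) * capped_exp a eps x) h0 h1 => h h0 h1.
move: (capped_exp a eps x) g0 => g g0.
have e0 := expR_gt0 (- (capped_exp_rate * t)); move: (expR _) e0 => e e0.
have -> : - capped_exp_rate * e * g + kappa * (e * (a ^+ 2 * (2 * h ^+ 2 - h) * g))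
    + (lambda * v + 2 * kappa * E) * (e * (a * h * g))
  = e * g * (kappa * a ^+ 2 * (2 * h ^+ 2 - h)
      + (lambda * a * v + 2 * kappa * E * a) * h - capped_exp_rate) by ring.
rewrite pmulr_rle0 ?mulr_gt0// /capped_exp_rate subr_le0.
have k0 : 0 <= kappa * a ^+ 2 by rewrite mulr_ge0 ?sqr_ge0.
have A1 : lambda * a * v <= `|lambda * a|.
  rewrite (le_trans (ler_norm _))// normrM.
  by case: hv => ->; rewrite ?normrN normr1 mulr1.
have A2 := ler_norm (2 * kappa * E * a).
have n1 := normr_ge0 (lambda * a); have n2 := normr_ge0 (2 * kappa * E * a).
rewrite addrC lerD//.
- apply: (@le_trans _ _ ((`|lambda * a| + `|2 * kappa * E * a|) * h)).
    by rewrite ler_wpM2r// lerD.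
  by rewrite ler_piMr// addr_ge0.
- by rewrite ler_piMr//; nra.
Qed.

End CappedExp.

Variable mu : R -> R -> R -> R.
Hypothesis fd : forward_density lambda kappa gamma E mu.

Lemma cont_total_density t : 0 < t -> continuous (fun x => mu x t 1 + mu x t (-1)).
Proof.
move=> t0; apply: continuous_pointwise => x.
apply: continuous1_add; apply: (density_cont fd) => //; [exact: velocity1|exact: velocityN1].
Qed.

Lemma total_density_ge0 x t : 0 < t -> 0 <= mu x t 1 + mu x t (-1).
Proof.
by move=> t0; rewrite addr_ge0// (fd_ge0 fd)//; [exact: velocity1|exact: velocityN1].
Qed.

Lemma cutoff_rate_ge0 : 0 <= cutoff_rate.
Proof. by rewrite addr_ge0// mulr_ge0// addr_ge0. Qed.

(** On [-r, r] the choice eps = exp(-|a| r) makes [capped_exp] at least half of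
    exp(a x). The cutoff is taken at a radius so large that it is at least 1/2
    on [-r, r] and that its error, though proportional to 1/eps, is at most 1;
    the resulting bound then depends neither on r nor on t. *)
Lemma exp_moment_segment a T : exists2 K, 0 <= K & forall r t, 0 < r -> 0 < t <= T ->
  \int[leb]_(x in `[- r, r]) (expR (a * x) * (mu x t 1 + mu x t (-1))) <= K.
Proof.
pose C := capped_exp_rate a.
exists (8 * expR (C * T)); first by rewrite mulr_ge0 ?expR_ge0.
move=> r t r0 tT; have /andP[t0 tT'] := tT; have T0 : 0 < T by lra.
have C0 : 0 <= C.
  by rewrite /C /capped_exp_rate !addr_ge0// mulr_ge0 ?sqr_ge0.
pose eps := expR (- (`|a| * r)).
have eps0 : 0 < eps by exact: expR_gt0.
pose M := (1 + `|a|) / eps.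
have M0 : 0 <= M by rewrite divr_ge0 ?(ltW eps0)// addr_ge0.
pose rr := 1 + 2 * r + cutoff_rate * M * T.
have cM : 0 <= cutoff_rate * M * T.
  by rewrite mulr_ge0 ?(ltW T0)// mulr_ge0// cutoff_rate_ge0.
have cW : continuous (cst M : R -> R) by move=> x; exact: cvg_cst.
have dom x s v : 0 <= s <= T -> is_velocity v ->
    `|expR (- (C * s)) * capped_exp a eps x| <= M /\
    `|expR (- (C * s)) * (a * (expR (- (a * x)) * capped_exp a eps x) * capped_exp a eps x)| <= M.
  move=> /andP[s0 _] _; have g0 := capped_exp_gt0 a eps0 x; have gM := capped_exp_le a eps0 x.
  have /andP[h0 h1] := capped_exp_ratio a eps0 x.
  have e1 : expR (- (C * s)) <= 1 by rewrite -expR0 ler_expR oppr_le0 mulr_ge0.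
  rewrite !(normrM (expR _)) ger0_norm ?expR_ge0// gtr0_norm//.
  have : `|a * (expR (- (a * x)) * capped_exp a eps x) * capped_exp a eps x| <= `|a| / eps.
    rewrite !normrM !(gtr0_norm (expR_gt0 _)) (gtr0_norm g0) ler_pM// ?(ltW g0)//.
      by rewrite mulr_ge0// mulr_ge0 ?expR_ge0 ?(ltW g0).
    by rewrite ler_piMr.
  have eV : 0 <= eps^-1 by rewrite invr_ge0 ltW.
  have := expR_ge0 (- (C * s)); have := normr_ge0 a.
  have ME : M = eps^-1 + `|a| / eps by rewrite /M mulrDl mul1r.
  rewrite ME => n0 e0 B.
  have aV : 0 <= `|a| / eps by rewrite mulr_ge0.
  split.
    by rewrite (le_trans (ler_piMl _ e1)) ?(ltW g0)//; lra.
  by rewrite (le_trans (ler_piMl _ e1))//; lra.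
have bdW s u : 0 < s -> 0 < u <= T ->
    \int[leb]_(x in `[- s, s]) (M * (mu x u 1 + mu x u (-1))) <= M.
  move=> s0 /andP[u0 _]; rewrite RintegralZl//; last first.
    by apply: integrable_segment; exact: cont_total_density.
  by rewrite ler_piMr// (mass_segment fd).
have sub x s v : 0 < s <= T -> is_velocity v -> _ :=
  fun _ hv => capped_exp_backward a eps0 x s hv.
have rr1 : 1 <= rr by rewrite /rr; lra.
have rr0 : 0 < rr by lra.
have main := cutoff_mean_le fd (capped_exp_smooth a eps0) cW dom bdW sub kappa_ge0 M0 rr1 tT.
rewrite mulr0 oppr0 expR0 mul1r /capped_exp mulr0 oppr0 expR0 in main.
have main2 : cutoff_mean rr mu (fun x t _ => expR (- (C * t)) * capped_exp a eps x) t <= 2.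
  apply: (le_trans main).
  have e1 : (1 + eps)^-1 <= 1 by rewrite invf_le1; lra.
  have : cutoff_rate * M * T / rr <= 1 by rewrite ler_pdivrMr//; rewrite /rr; lra.
  lra.
pose h x := cutoff rr x * (expR (- (C * t)) * capped_exp a eps x * mu x t 1
  + expR (- (C * t)) * capped_exp a eps x * mu x t (-1)).
have hE x : h x = cutoff rr x * (expR (- (C * t)) * capped_exp a eps x)
    * (mu x t 1 + mu x t (-1)) by rewrite /h; ring.
have ch : continuous h.
  have cq := cont_total_density t0.
  rewrite (_ : h = fun x => cutoff rr x * (expR (- (C * t)) * capped_exp a eps x)
    * (mu x t 1 + mu x t (-1))); last exact/funext.
  apply: continuous_pointwise => x; apply: continuous1_mul; last exact: cq.
  apply: continuous1_mul; first exact: cutoff_cont.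
  by apply: continuous1_mul; [exact: continuous1_cst|exact: continuous_capped_exp].
have h0 x : 0 <= h x.
  rewrite hE mulr_ge0 ?total_density_ge0// mulr_ge0 ?cutoff_ge0//.
  by rewrite mulr_ge0 ?expR_ge0 ?(ltW (capped_exp_gt0 _ _ _)).
have hr : \int[leb]_(x in `[- r, r]) h x <= 2.
  by apply: le_trans main2; apply: Rintegral_subset => //; rewrite /rr; lra.
have -> : 8 * expR (C * T) = 4 * expR (C * T) * 2 by ring.
apply: (@le_trans _ _ (4 * expR (C * T) * \int[leb]_(x in `[- r, r]) h x)); last first.
  by rewrite ler_wpM2l// mulr_ge0 ?expR_ge0.
rewrite -RintegralZl//; last exact: integrable_segment.
apply: le_Rintegral => //.
- apply: integrable_segment; apply: continuous_pointwise => x.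
  by apply: continuous1_mul; [repeat continuous_rules|exact: (cont_total_density t0)].
- apply: integrable_segment; apply: continuous_pointwise => x.
  by apply: continuous1_mul; [exact: continuous1_cst|exact: ch].
move=> x; rewrite /= in_itv/= => /andP[x1 x2].
rewrite hE mulrA ler_wpM2r ?total_density_ge0//.
have xa : a * x <= `|a| * r.
  rewrite (le_trans (ler_norm _))// normrM ler_wpM2l//.
  by rewrite ler_norml x1.
have epsx : eps <= expR (- (a * x)) by rewrite ler_expR lerN2.
have gx : expR (a * x) / 2 <= capped_exp a eps x.
  rewrite -[expR (a * x)]invrK -expRN -invfM lef_pV2 ?posrE ?capped_exp_den_gt0//.
    by lra.
  by rewrite mulr_gt0 ?expR_gt0.
have chix : 2^-1 <= cutoff rr x.
  have y1 : - 2^-1 <= x / rr by rewrite ler_pdivlMr// /rr; lra.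
  have y2 : x / rr <= 2^-1 by rewrite ler_pdivrMr// /rr; lra.
  rewrite /cutoff; move: (x / rr) y1 y2 => y y1 y2.
  have : y ^+ 2 <= 4^-1 by nra.
  by have := sqr_ge0 y; nra.
have eT : 1 <= expR (C * T) * expR (- (C * t)).
  by rewrite -expRD -expR0 ler_expR subr_ge0 ler_wpM2l.
have -> : 4 * expR (C * T) * (cutoff rr x * (expR (- (C * t)) * capped_exp a eps x))
  = 4 * (expR (C * T) * expR (- (C * t))) * (cutoff rr x * capped_exp a eps x) by ring.
have p : 2^-1 * (expR (a * x) / 2) <= cutoff rr x * capped_exp a eps x.
  by rewrite ler_pM// ?invr_ge0// divr_ge0// expR_ge0.
have p0 : 0 <= cutoff rr x * capped_exp a eps x.
  by rewrite mulr_ge0 ?cutoff_ge0// ltW// capped_exp_gt0.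
have : cutoff rr x * capped_exp a eps x <=
    (expR (C * T) * expR (- (C * t))) * (cutoff rr x * capped_exp a eps x).
  by rewrite ler_peMl.
by lra.
Qed.

Section Duality.
Variables (phi phi_t phi_x phi_xx : R -> R -> R -> R).
Hypothesis st : smooth_test phi phi_t phi_x phi_xx.

Lemma smooth_test_opp : smooth_test (fun x t v => - phi x t v)
  (fun x t v => - phi_t x t v) (fun x t v => - phi_x x t v)
  (fun x t v => - phi_xx x t v).
Proof.
split.
- by move=> x t v; apply: is_derive1_opp; exact: (st_dt st).
- by move=> x t v; apply: is_derive1_opp; exact: (st_dx st).
- by move=> x t v; apply: is_derive1_opp; exact: (st_dxx st).
- by move=> v p; apply: continuous1_opp; exact: (st_cont st).
- by move=> v p; apply: continuous1_opp; exact: (st_cont_dt st).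
- by move=> t v x; apply: continuous1_opp; exact: (st_cont_dxx st).
Qed.

Lemma paired_density_continuous t : 0 < t ->
  continuous (fun x => phi x t 1 * mu x t 1 + phi x t (-1) * mu x t (-1)).
Proof.
move=> t0; apply: continuous_pointwise => x.
by apply: continuous1_add; apply: continuous1_mul; first [exact: (test_cont st)
  | apply: (density_cont fd) => //; solve [exact: velocity1|exact: velocityN1]].
Qed.

(** Both phi and -phi satisfy [cutoff_mean_le], so the truncated pairing is
    within O(1/r) of its initial value; W mu dominates as r tends to infinity. *)
Lemma backward_duality W T K : continuous W -> 0 < T ->
    (forall x t v, 0 <= t <= T -> is_velocity v ->
       `|phi x t v| <= W x /\ `|phi_x x t v| <= W x) ->
    (forall r t, 0 < r -> 0 < t <= T ->
       \int[leb]_(x in `[- r, r]) (W x * (mu x t 1 + mu x t (-1))) <= K) ->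
    (forall x t v, 0 < t <= T -> is_velocity v ->
       backward phi phi_t phi_x phi_xx x t v = 0) ->
  (\int[leb]_x (phi x T 1 * mu x T 1 + phi x T (-1) * mu x T (-1))%:E
   = ((phi 0 0 1 + phi 0 0 (-1)) / 2)%:E)%E.
Proof.
move=> cW T0 dom bdW bw0.
have TT : 0 < T <= T by rewrite T0 lexx.
have W0 x : 0 <= W x.
  by apply: (le_trans (normr_ge0 (phi x 0 1))); apply: (dom x 0 1 _ velocity1).1;
    rewrite lexx ltW.
have Wq0 x : 0 <= W x * (mu x T 1 + mu x T (-1)).
  by rewrite mulr_ge0// total_density_ge0.
have K0 : 0 <= K.
  by apply: le_trans (bdW 1 T ltr01 TT); apply: Rintegral_ge0.
have cWq : continuous (fun x => W x * (mu x T 1 + mu x T (-1))).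
  by apply: continuous_pointwise => x; apply: continuous1_mul; [exact: cW|exact: cont_total_density].
have intWq : leb.-integrable setT (EFin \o (fun x => W x * (mu x T 1 + mu x T (-1)))).
  by apply: (@integrable_of_segments _ _ K) => // r r0; exact: bdW.
set A := (phi 0 0 1 + _) / 2.
pose S x := phi x T 1 * mu x T 1 + phi x T (-1) * mu x T (-1).
have cS : continuous S by exact: paired_density_continuous.
pose rn (n : nat) : R := n.+1%:R.
have rn1 n : 1 <= rn n by rewrite /rn ler1n.
have close n : `|cutoff_mean (rn n) mu phi T - A| <= cutoff_rate * K * T / rn n.
  have up : cutoff_mean (rn n) mu phi T <= A + cutoff_rate * K * T / rn n.
    apply: (cutoff_mean_le fd st cW dom bdW) => // x t v tT hv.
    by rewrite bw0.
  have lo : cutoff_mean (rn n) mu (fun x t v => - phi x t v) T <=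
      - A + cutoff_rate * K * T / rn n.
    rewrite (_ : - A = (- phi 0 0 1 + - phi 0 0 (-1)) / 2); last by rewrite /A; ring.
    apply: (cutoff_mean_le fd smooth_test_opp cW _ bdW) => //.
    - by move=> x t v tT hv; rewrite !normrN; exact: dom.
    - move=> x t v tT hv.
      rewrite (_ : backward _ _ _ _ _ _ _ = - backward phi phi_t phi_x phi_xx x t v).
        by rewrite bw0// oppr0.
      by rewrite /backward_residual; ring.
  have neg : cutoff_mean (rn n) mu (fun x t v => - phi x t v) T
      = - cutoff_mean (rn n) mu phi T.
    rewrite /cutoff_mean -[RHS]mulN1r -RintegralZl//; last first.
      apply: integrable_segment; apply: continuous_pointwise => x; apply: continuous1_mul.
        exact: cutoff_cont.
      exact: cS.
    by apply: eq_Rintegral => x _; ring.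
  rewrite neg in lo; move: up lo; set e := _ / rn n; move: (cutoff_mean _ _ _ _) A e => Y B e up lo.
  by rewrite ler_norml; apply/andP; split; lra.
have Yn_cvg : cutoff_mean (rn n) mu phi T @[n --> \oo] --> A.
  have inv_cvg : (rn n)^-1 @[n --> \oo] --> (0 : R) by exact: cvg_harmonic.
  have c0 : cutoff_rate * K * T / rn n @[n --> \oo] --> (0 : R).
    rewrite -[X in _ --> X](mulr0 (cutoff_rate * K * T)).
    by apply: cvgM => //; exact: cvg_cst.
  apply/subr_cvg0; apply: norm_cvg0.
  apply: (@squeeze_cvgr _ _ _ _ (cst 0) _ _ _ _ _ c0); last exact: cvg_cst.
  by apply: nearW => n; rewrite normr_ge0/= close.
pose g n := (fun x => cutoff (rn n) x * S x) \_ `[- rn n, rn n].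
have gE n : (\int[leb]_x (g n x)%:E)%E = (cutoff_mean (rn n) mu phi T)%:E.
  rewrite /cutoff_mean /Rintegral fineK.
    by rewrite [RHS]integral_mkcond; apply: eq_integral => x _; rewrite /g !patchE; case: ifP.
  apply: integrable_fin_num => //; apply: integrable_segment.
  apply: continuous_pointwise => x; apply: continuous1_mul; [exact: cutoff_cont|exact: cS].
have cvg1 x : cutoff (rn n) x @[n --> \oo] --> (1 : R).
  have inv_cvg : (rn n)^-1 @[n --> \oo] --> (0 : R) by exact: cvg_harmonic.
  pose P y : R := (1 - (x * y) ^+ 2) ^+ 2.
  have cP : {for 0, continuous P} by rewrite /P; repeat continuous_rules.
  have P0 : P 0 = 1 by rewrite /P mulr0 expr0n subr0 expr1n.
  by rewrite -P0; exact: (continuous_cvg _ cP inv_cvg).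
have gcvg x : g n x @[n --> \oo] --> S x.
  have lim1 : cutoff (rn n) x * S x @[n --> \oo] --> S x.
    by rewrite -[X in _ --> X]mul1r; apply: cvgM => //; exact: cvg_cst.
  apply: cvg_trans lim1; apply: near_eq_cvg; near=> n.
  rewrite /g patchE mem_set//= in_itv/= -ler_norml.
  rewrite (le_trans (ltW (Num.Theory.truncnS_gt `|x|)))// ler_nat ltnS.
  by near: n; exact: nbhs_infty_ge.
have mg n : measurable_fun setT (fun x => (g n x)%:E).
  apply/measurable_EFinP; apply/(measurable_restrictT _ _).1 => //.
  apply: measurable_funTS; apply: continuous_measurable_fun.
  apply: continuous_pointwise => x; apply: continuous1_mul; [exact: cutoff_cont|exact: cS].
have mS : measurable_fun setT (EFin \o S).
  by apply/measurable_EFinP; exact: continuous_measurable_fun.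
have dom_g : {ae leb, forall x n, setT x ->
    (`|(g n x)%:E| <= (W x * (mu x T 1 + mu x T (-1)))%:E)%E}.
  apply: aeW => x n _; rewrite lee_fin /g patchE; case: ifPn => [|_]; last by rewrite normr0.
  rewrite inE/= in_itv/= => xr.
  have rn0 : 0 < rn n by exact: lt_le_trans (rn1 n).
  rewrite normrM (ger0_norm (cutoff_ge0 _ _)).
  rewrite (le_trans (ler_piMl _ (cutoff_le1 rn0 xr)))// /S.
  have T01 : 0 <= T <= T by rewrite lexx ltW.
  have term v : is_velocity v -> `|phi x T v * mu x T v| <= W x * mu x T v.
    move=> hv; have m0 := fd_ge0 fd x T0 hv.
    by rewrite normrM (ger0_norm m0) ler_wpM2r//; exact: (dom x T v T01 hv).1.
  rewrite (le_trans (ler_normD _ _))// mulrDr lerD// term//.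
    exact: velocity1.
  exact: velocityN1.
have ae_cvg : {ae leb, forall x, setT x ->
    (g n x)%:E @[n --> \oo] --> (EFin \o S) x}.
  by apply: aeW => x _; apply: cvg_EFin; [exact: nearW|exact: gcvg].
have [_ _] := @dominated_convergence _ (measurableTypeR R) R leb setT measurableT
  (fun n x => (g n x)%:E) (EFin \o S) _ mg mS ae_cvg intWq dom_g.
under eq_fun do rewrite gE.
move=> lim1; apply: (cvg_unique _ lim1) => //.
by apply: cvg_EFin => //; exact: nearW.
Unshelve. all: by end_near. Qed.

End Duality.
End Moments.

(** * Expectations as integrals against the density *)

Section Density.
Context {R : realType}.
Local Notation leb := (@lebesgue_measure R).
Local Open Scope ereal_scope.

(** q is almost everywhere the Radon-Nikodym derivative of nu. *)
Lemma ge0_integral_density (nu : {finite_measure set (measurableTypeR R) -> \bar R})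
    (q : measurableTypeR R -> R) (f : measurableTypeR R -> \bar R) :
    measurable_fun setT q -> (forall x, 0 <= q x)%R ->
    (forall A, measurable A -> nu A = \int[leb]_(x in A) (q x)%:E) ->
    measurable_fun setT f -> (forall x, 0 <= f x) ->
  \int[nu]_x f x = \int[leb]_x (f x * (q x)%:E).
Proof.
move=> mq q0 nuE mf f0.
have mqE : measurable_fun setT (EFin \o q) by exact/measurable_EFinP.
have numu : nu `<< leb.
  apply/null_content_dominatesP => A mA A0; rewrite nuE//.
  by apply: null_set_integral => //; exact: measurable_funTS.
rewrite -(Radon_Nikodym_SigmaFinite.change_of_variables numu f0 measurableT mf).
have intf := Radon_Nikodym_SigmaFinite.f_integrable numu.
have mRN := measurable_int _ intf.
apply: ae_eq_integral => //.
- exact: emeasurable_funM.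
- exact: emeasurable_funM.
apply: ae_eqe_mul2l; apply: (integral_ae_eq measurableT intf mqE) => A _ mA.
by rewrite -nuE// -Radon_Nikodym_SigmaFinite.f_integral.
Qed.

(** Stated for the positive and negative parts separately, so that f o X need
    not be integrable. *)
Lemma expectation_density d (T : measurableType d) (P : probability T R)
    (X : {RV P >-> R}) (q f : R -> R) :
    measurable_fun setT q -> (forall x, 0 <= q x)%R ->
    (forall A : set R, measurable A ->
       P (X @^-1` A) = \int[leb]_(x in A) (q x)%:E) ->
    measurable_fun setT f ->
  'E_P[f \o X] = \int[leb]_x (f x * q x)%:E.
Proof.
move=> mq q0 law mf.
(* The reals carry two measurable structures with the same measurable sets but
   different displays; Lebesgue measure lives on [measurableTypeR]. *)
have mX : measurable_fun setT (X : T -> measurableTypeR R).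
  by have H := @measurable_funPT _ _ _ _ X => mT A mA; exact: (H mT A mA).
pose X' : {RV P >-> measurableTypeR R} :=
  @mfun_Sub _ _ T (measurableTypeR R) X (mem_set mX).
have part (g : R -> \bar R) : measurable_fun setT g -> (forall x, 0 <= g x) ->
    \int[P]_w g (X w) = \int[leb]_x (g x * (q x)%:E).
  move=> mg g0; rewrite -(@ge0_integral_density (distribution P X') q g)//.
  by rewrite ge0_integral_distribution.
have mfE : measurable_fun setT (EFin \o f) by exact/measurable_EFinP.
rewrite unlock [LHS]integralE [RHS]integralE; congr (_ - _).
- transitivity (\int[P]_w (EFin \o f)^\+ (X w)).
    by apply: eq_integral => w _; rewrite !funeposE.
  rewrite part//; last exact: measurable_funepos.
  apply: eq_integral => x _; rewrite !funeposE /=.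
  by rewrite -!EFin_max -EFinM maxr_pMl// mul0r.
- transitivity (\int[P]_w (EFin \o f)^\- (X w)).
    by apply: eq_integral => w _; rewrite !funenegE.
  rewrite part//; last exact: measurable_funeneg.
  apply: eq_integral => x _; rewrite !funenegE /=.
  by rewrite -!EFin_max -EFinM maxr_pMl// mul0r mulNr.
Qed.

End Density.

Section Telegrapher.
Context {R : realType}.
Variables lambda kappa gamma E : R.
Variable Z : telegrapher lambda kappa gamma E.
Implicit Types t v x : R.
Local Notation leb := (@lebesgue_measure R).
Local Notation mu := (tp_mu Z).
Local Notation P := (tp_prob Z).

Lemma slice_measurable t v : 0 < t -> is_velocity v ->
  measurable_fun setT (fun x => mu x t v).
Proof.
move=> t0 hv; apply: continuous_measurable_fun => x.
have [_ H _ _] := tp_regular Z hv x t0.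
by apply/differentiable_continuous/derivable1_diffP.
Qed.

Lemma law_density t (A : set R) : 0 < t -> measurable A ->
  P (tp_X Z t @^-1` A) = (\int[leb]_(x in A) (mu x t 1 + mu x t (-1))%:E)%E.
Proof.
move=> t0 mA.
have mXv v : measurable [set w | A (tp_X Z t w) /\ tp_v Z t w = v].
  have mX : measurable (tp_X Z t @^-1` A) by rewrite -[X in measurable X]setTI; apply: measurable_funPT.
  have mv : measurable (tp_v Z t @^-1` [set v]) by rewrite -[X in measurable X]setTI; apply: measurable_funPT.
  exact: measurableI mX mv.
have -> : tp_X Z t @^-1` A =
    [set w | A (tp_X Z t w) /\ tp_v Z t w = 1] `|`
    [set w | A (tp_X Z t w) /\ tp_v Z t w = -1].
  apply/seteqP; split=> [w /= Aw|w /= [[]//|[]//]].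
  by have [] := tp_velocity w (ltW t0) => ->; [left|right].
rewrite measureU//; last first.
  by apply/seteqP; split => // w /= [[_ ->] [_ h]]; lra.
transitivity (\int[leb]_(x in A) (mu x t 1)%:E + \int[leb]_(x in A) (mu x t (-1))%:E)%E.
  congr (_ + _)%E; [exact: (tp_density Z t0 velocity1 mA)|exact: (tp_density Z t0 velocityN1 mA)].
rewrite -ge0_integralD//.
- by move=> x _; rewrite lee_fin; exact: (tp_mu_ge0 Z _ t0 velocity1).
- by apply/measurable_EFinP; apply: measurable_funTS; exact: (slice_measurable t0 velocity1).
- by move=> x _; rewrite lee_fin; exact: (tp_mu_ge0 Z _ t0 velocityN1).
- by apply/measurable_EFinP; apply: measurable_funTS; exact: (slice_measurable t0 velocityN1).
Qed.

Lemma telegrapher_density : forward_density lambda kappa gamma E mu.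
Proof.
split.
- by move=> x t v; exact: tp_mu_ge0.
- by move=> t t0; rewrite -law_density// preimage_setT probability_setT.
- exact: tp_regular.
- exact: tp_forward.
- exact: tp_initial.
Qed.

Lemma expectation_telegrapher t (f : R -> R) : 0 < t -> continuous f ->
  ('E_P[f \o tp_X Z t] = \int[leb]_x (f x * (mu x t 1 + mu x t (-1)))%:E)%E.
Proof.
move=> t0 cf; apply: expectation_density.
- by apply: measurable_funD; [exact: (slice_measurable t0 velocity1)|exact: (slice_measurable t0 velocityN1)].
- by move=> x; exact: (total_density_ge0 telegrapher_density).
- by move=> A mA; exact: law_density.
- exact: continuous_measurable_fun.
Qed.

End Telegrapher.

(** * Exact moment generating function, mean and variance *)

Section ExactLaws.
Context {R : realType}.
Variables lambda kappa gamma E : R.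
Hypothesis kappa_ge0 : 0 <= kappa.
Hypothesis gamma_gt0 : 0 < gamma.
Variable Z : telegrapher lambda kappa gamma E.
Local Notation leb := (@lebesgue_measure R).
Local Notation mu := (tp_mu Z).
Local Notation P := (tp_prob Z).
Local Notation c := (2 * kappa * E).
Implicit Types (a t T x v : R) (f W : R -> R).

Lemma expectation_backward phi phi_t phi_x phi_xx f W T K :
    smooth_test phi phi_t phi_x phi_xx -> continuous W -> continuous f -> 0 < T ->
    (forall x t v, 0 <= t <= T -> is_velocity v ->
       `|phi x t v| <= W x /\ `|phi_x x t v| <= W x) ->
    (forall r t, 0 < r -> 0 < t <= T ->
       \int[leb]_(x in `[- r, r]) (W x * (mu x t 1 + mu x t (-1))) <= K) ->
    (forall x t v, 0 < t <= T -> is_velocity v ->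
       backward_residual lambda kappa gamma E phi phi_t phi_x phi_xx x t v = 0) ->
    (forall x v, is_velocity v -> phi x T v = f x) ->
  ('E_P[f \o tp_X Z T] = ((phi 0 0 1 + phi 0 0 (-1)) / 2)%:E)%E.
Proof.
move=> st cW cf T0 dom bdW bw0 phiT.
rewrite expectation_telegrapher// -(backward_duality kappa_ge0 (telegrapher_density Z) st cW T0 dom bdW bw0).
apply: eq_integral => x _; congr EFin.
by rewrite (phiT _ _ velocity1) (phiT _ _ velocityN1) mulrDr.
Qed.

(** 1 + x^2 <= 5 (exp x + exp (-x)), from 1 + |x|/2 <= exp (|x|/2). *)
Lemma quadratic_moment_segment B T : 0 <= B -> exists K, forall r t, 0 < r -> 0 < t <= T ->
  \int[leb]_(x in `[- r, r]) (B * (1 + x ^+ 2) * (mu x t 1 + mu x t (-1))) <= K.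
Proof.
move=> B0; have fd := telegrapher_density Z.
have [K1 K10 hK1] := exp_moment_segment kappa_ge0 fd 1 T.
have [K2 K20 hK2] := exp_moment_segment kappa_ge0 fd (-1) T.
exists (5 * B * (K1 + K2)) => r t r0 tT; have /andP[t0 _] := tT.
have cE (a : R) : continuous (fun x => expR (a * x) * (mu x t 1 + mu x t (-1))).
  apply: continuous_pointwise => x; apply: continuous1_mul; first by repeat continuous_rules.
  exact: (cont_total_density fd t0).
apply: (@le_trans _ _ (5 * B * (\int[leb]_(x in `[- r, r]) (expR (1 * x) * (mu x t 1 + mu x t (-1)))
   + \int[leb]_(x in `[- r, r]) (expR (-1 * x) * (mu x t 1 + mu x t (-1)))))); last first.
  by rewrite ler_wpM2l ?mulr_ge0// lerD ?hK1 ?hK2.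
rewrite -RintegralD//; [|by apply: integrable_segment; exact: cE..].
have cS : continuous (fun x => expR (1 * x) * (mu x t 1 + mu x t (-1))
    + expR (-1 * x) * (mu x t 1 + mu x t (-1))).
  by apply: continuous_pointwise => x; apply: continuous1_add; exact: cE.
rewrite -RintegralZl//; last exact: integrable_segment.
apply: le_Rintegral => //.
- apply: integrable_segment; apply: continuous_pointwise => x.
  by apply: continuous1_mul; [repeat continuous_rules|exact: (cont_total_density fd t0)].
- apply: integrable_segment; apply: continuous_pointwise => x.
  by apply: continuous1_mul; [exact: continuous1_cst|exact: cS].
move=> x _; rewrite -mulrDl mulrA ler_wpM2r ?(total_density_ge0 fd)//.
rewrite (mulrC 5) -mulrA ler_wpM2l// mul1r mulN1r.
have half (y : R) : 0 <= y -> 1 + y ^+ 2 <= 5 * expR y.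
  move=> y0; have h : 1 + y / 2 <= expR (y / 2) by exact: expR_ge1Dx.
  have -> : expR y = expR (y / 2) ^+ 2 by rewrite -expRM_natl; congr expR; field.
  have := expR_ge0 (y / 2); nra.
have [x0|x0] := leP 0 x.
  by have := half x x0; have := expR_ge0 (- x); lra.
by have := half (- x); rewrite sqrrN; have := expR_ge0 x; lra.
Qed.

Section MomentGenerating.
Variables (a T : R).
Hypothesis T_gt0 : 0 < T.

Definition mgf_root : R := Num.sqrt (lambda ^+ 2 * a ^+ 2 + gamma ^+ 2).
(** For sgn = 1 and -1 these are the two spectral projections of the velocity
    system applied to the constant function 1. *)
Definition mgf_weight (sgn v : R) : R := (1 + sgn * ((gamma + lambda * a * v) / mgf_root)) / 2.
Definition mgf_exponent (sgn : R) : R :=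
  kappa * a ^+ 2 + c * a - gamma + sgn * mgf_root.

Lemma mgf_root_sqr : mgf_root ^+ 2 = lambda ^+ 2 * a ^+ 2 + gamma ^+ 2.
Proof. by rewrite sqr_sqrtr// addr_ge0 ?sqr_ge0// mulr_ge0 ?sqr_ge0. Qed.

Lemma mgf_root_gt0 : 0 < mgf_root.
Proof.
by rewrite sqrtr_gt0 ltr_wpDl ?exprn_gt0// mulr_ge0 ?sqr_ge0.
Qed.

Definition mgf_test (x t v : R) : R :=
  expR (a * x) * (mgf_weight 1 v * expR (mgf_exponent 1 * (T - t))
                  + mgf_weight (-1) v * expR (mgf_exponent (-1) * (T - t))).
Definition mgf_test_t (x t v : R) : R :=
  expR (a * x) * (mgf_weight 1 v * (expR (mgf_exponent 1 * (T - t)) * - mgf_exponent 1)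
    + mgf_weight (-1) v * (expR (mgf_exponent (-1) * (T - t)) * - mgf_exponent (-1))).

Lemma mgf_test_smooth : smooth_test mgf_test mgf_test_t
  (fun x t v => a * mgf_test x t v) (fun x t v => a ^+ 2 * mgf_test x t v).
Proof.
rewrite /mgf_test /mgf_test_t.
split=> [x t v|x t v|x t v|v|v|t v].
- by eapply is_derive_eq; [repeat derive_rules|rewrite /=; ring].
- by eapply is_derive_eq; [repeat derive_rules|rewrite /=; ring].
- by eapply is_derive_eq; [repeat derive_rules|rewrite /=; ring].
- by apply: continuous_pointwise => p; repeat continuous_rules.
- by apply: continuous_pointwise => p; repeat continuous_rules.
- by apply: continuous_pointwise => p; repeat continuous_rules.
Qed.

Lemma mgf_test_backward x t v : is_velocity v ->
  backward_residual lambda kappa gamma E mgf_test mgf_test_t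
    (fun x t v => a * mgf_test x t v) (fun x t v => a ^+ 2 * mgf_test x t v) x t v = 0.
Proof.
move=> hv; have s0 := lt0r_neq0 mgf_root_gt0; have s2 := mgf_root_sqr.
have v2 : v ^+ 2 = 1 by case: hv => ->; rewrite ?sqrrN expr1n.
have key sgn : sgn ^+ 2 = 1 ->
    mgf_weight sgn v * (gamma + lambda * a * v - sgn * mgf_root)
    + gamma * (mgf_weight sgn (- v) - mgf_weight sgn v) = 0.
  move=> sg2; rewrite /mgf_weight.
  apply: (mulfI s0); rewrite mulr0.
  transitivity ((mgf_root * (gamma - gamma) + sgn * (lambda ^+ 2 * a ^+ 2 * v ^+ 2 + gamma ^+ 2
    - mgf_root ^+ 2 ) + mgf_root * (gamma + lambda * a * v) * (1 - sgn ^+ 2)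
    - sgn * mgf_root ^+2 + sgn * mgf_root ^+ 2) / 2).
    by field.
  by rewrite v2 s2 sg2; ring.
have k1 := key 1 (expr1n _ _).
have k2 := key (-1) (etrans (sqrrN _) (expr1n _ _)).
rewrite /backward_residual /drift /mgf_test /mgf_test_t.
move: (expR (a * x)) (expR (mgf_exponent 1 * _)) (expR (mgf_exponent (-1) * _)) => e0 e1 e2.
rewrite /mgf_exponent.
have <- : e0 * (e1 * (mgf_weight 1 v * (gamma + lambda * a * v - 1 * mgf_root)
    + gamma * (mgf_weight 1 (- v) - mgf_weight 1 v))
  + e2 * (mgf_weight (-1) v * (gamma + lambda * a * v - (-1) * mgf_root)
    + gamma * (mgf_weight (-1) (- v) - mgf_weight (-1) v))) = 0.
  by rewrite k1 k2 !mulr0 addr0 mulr0.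
by ring.
Qed.

Definition mgf_bound : R :=
  (`|mgf_weight 1 1| + `|mgf_weight 1 (-1)|) * expR (`|mgf_exponent 1| * T)
  + (`|mgf_weight (-1) 1| + `|mgf_weight (-1) (-1)|) * expR (`|mgf_exponent (-1)| * T).

Lemma mgf_test_le x t v : 0 <= t <= T -> is_velocity v ->
  `|mgf_test x t v| <= mgf_bound * expR (a * x).
Proof.
move=> /andP[t0 tT] hv.
rewrite /mgf_test normrM (ger0_norm (expR_ge0 _)) mulrC ler_wpM2r ?expR_ge0//.
have e sgn : expR (mgf_exponent sgn * (T - t)) <= expR (`|mgf_exponent sgn| * T).
  rewrite ler_expR (le_trans (ler_norm _))// normrM ler_wpM2l// ger0_norm; lra.
have w sgn : `|mgf_weight sgn v| <= `|mgf_weight sgn 1| + `|mgf_weight sgn (-1)|.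
  by case: hv => ->; [rewrite lerDl|rewrite lerDr].
rewrite (le_trans (ler_normD _ _))// lerD// normrM (ger0_norm (expR_ge0 _));
  by rewrite ler_pM ?expR_ge0.
Qed.

Lemma mgf_telegrapher :
  ('M_P (tp_X Z T) a = (((1 + gamma / mgf_root) * expR (mgf_exponent 1 * T)
     + (1 - gamma / mgf_root) * expR (mgf_exponent (-1) * T)) / 2)%:E)%E.
Proof.
have [K K0 hK] := exp_moment_segment kappa_ge0 (telegrapher_density Z) a T.
pose B := (1 + `|a|) * mgf_bound.
have b0 : 0 <= mgf_bound by rewrite addr_ge0// mulr_ge0 ?expR_ge0// addr_ge0.
have B0 : 0 <= B by rewrite mulr_ge0// addr_ge0.
pose W x := B * expR (a * x).
have cW : continuous W.
  by apply: continuous_pointwise => x; rewrite /W; repeat continuous_rules.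
have cf : continuous (fun x => expR (a * x)).
  by apply: continuous_pointwise => x; repeat continuous_rules.
have dom x t v : 0 <= t <= T -> is_velocity v ->
    `|mgf_test x t v| <= W x /\ `|a * mgf_test x t v| <= W x.
  move=> tT hv; have := mgf_test_le x tT hv; have := normr_ge0 (mgf_test x t v).
  rewrite (normrM a) /W /B -mulrA; have := normr_ge0 a; move: (mgf_bound * _) => m a0 p0 pm.
  have m0 : 0 <= m := le_trans p0 pm.
  split; first by rewrite (le_trans pm)// ler_peMl// lerDl.
  by rewrite ler_pM// lerDr.
have bdW r t : 0 < r -> 0 < t <= T ->
    \int[leb]_(x in `[- r, r]) (W x * (mu x t 1 + mu x t (-1))) <= B * K.
  move=> r0 tT; have /andP[t0 _] := tT.
  have ce : continuous (fun x => expR (a * x) * (mu x t 1 + mu x t (-1))).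
    apply: continuous_pointwise => x; apply: continuous1_mul; first exact: cf.
    exact: (cont_total_density (telegrapher_density Z) t0).
  have -> : \int[leb]_(x in `[- r, r]) (W x * (mu x t 1 + mu x t (-1)))
      = B * \int[leb]_(x in `[- r, r]) (expR (a * x) * (mu x t 1 + mu x t (-1))).
    rewrite -RintegralZl//; last exact: integrable_segment.
    by apply: eq_Rintegral => x _; rewrite /W mulrA.
  by rewrite ler_wpM2l// hK.
have bw x t v : 0 < t <= T -> is_velocity v -> _ := fun _ hv => mgf_test_backward x t hv.
have fin x v : is_velocity v -> mgf_test x T v = expR (a * x).
  by move=> _; rewrite /mgf_test subrr !mulr0 expR0 /mgf_weight; field; exact: lt0r_neq0 mgf_root_gt0.
rewrite /mmt_gen_fun.
have -> : expR \o (a \o* tp_X Z T) = (fun x => expR (a * x)) \o tp_X Z T.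
  by apply/funext => w /=; rewrite mulrC.
rewrite (expectation_backward mgf_test_smooth cW cf T_gt0 dom bdW bw fin).
congr EFin; rewrite /mgf_test mulr0 expR0 !subr0 /mgf_weight.
by field; exact: lt0r_neq0 mgf_root_gt0.
Qed.

End MomentGenerating.

Section MeanVariance.
Variable T : R.
Hypothesis T_gt0 : 0 < T.

(** The expected velocity decays at rate 2 gamma; this factor makes the
    corrections below vanish at time T. *)
Definition relaxation t : R := 1 - expR (- (2 * gamma * (T - t))).
Definition relaxation_t t : R := - (2 * gamma * expR (- (2 * gamma * (T - t)))).

Lemma relaxation_tE t : relaxation_t t = - (2 * gamma * (1 - relaxation t)).
Proof. by rewrite /relaxation_t /relaxation; ring. Qed.

Lemma relaxation_bounds t : t <= T -> 0 <= relaxation t <= 1.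
Proof.
move=> tT; rewrite /relaxation; apply/andP; split.
  by rewrite subr_ge0 -[leRHS]expR0 ler_expR oppr_le0 !mulr_ge0 ?subr_ge0// ltW.
by rewrite lerBlDr lerDl expR_ge0.
Qed.

(** Backward solution with terminal value x. The last term is the expected
    displacement due to the velocity during the remaining time T - t. *)
Definition mean_test x t v : R := x + c * (T - t) + lambda / (2 * gamma) * v * relaxation t.
Definition mean_test_t x t v : R := - c + lambda / (2 * gamma) * v * relaxation_t t.

Lemma mean_test_smooth : smooth_test mean_test mean_test_t (fun _ _ _ => 1) (fun _ _ _ => 0).
Proof.
rewrite /mean_test /mean_test_t /relaxation /relaxation_t.
split=> [x t v|x t v|x t v|v|v|t v].
- by eapply is_derive_eq; [repeat derive_rules|rewrite /=; ring].
- by eapply is_derive_eq; [repeat derive_rules|rewrite /=; ring].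
- exact: is_derive1_cst.
- by apply: continuous_pointwise => p; repeat continuous_rules.
- by apply: continuous_pointwise => p; repeat continuous_rules.
- by apply: continuous_pointwise => p; repeat continuous_rules.
Qed.

Lemma mean_test_backward x t v :
  backward_residual lambda kappa gamma E mean_test mean_test_t (fun _ _ _ => 1) (fun _ _ _ => 0) x t v = 0.
Proof.
rewrite /backward_residual /drift /mean_test /mean_test_t relaxation_tE.
by field; exact: lt0r_neq0.
Qed.

(** Backward solution with terminal value (x - 2 kappa E T)^2: the cross term
    cancels 2 lambda v (x - 2 kappa E t), and what it leaves, together with the
    Brownian term, is integrated in time. *)
Definition square_test x t v : R :=
  (x - c * t) ^+ 2 + lambda / gamma * ((x - c * t) * v * relaxation t)
  + ((2 * kappa + lambda ^+ 2 / gamma) * (T - t) - lambda ^+ 2 / (2 * gamma ^+ 2) * relaxation t).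
Definition square_test_t x t v : R :=
  - (2 * c * (x - c * t))
  + lambda / gamma * v * ((x - c * t) * relaxation_t t - c * relaxation t)
  - ((2 * kappa + lambda ^+ 2 / gamma) + lambda ^+ 2 / (2 * gamma ^+ 2) * relaxation_t t).
Definition square_test_x x t v : R := 2 * (x - c * t) + lambda / gamma * v * relaxation t.

Lemma square_test_smooth :
  smooth_test square_test square_test_t square_test_x (fun _ _ _ => 2).
Proof.
rewrite /square_test /square_test_t /square_test_x /relaxation /relaxation_t.
split=> [x t v|x t v|x t v|v|v|t v].
- by eapply is_derive_eq; [repeat derive_rules|rewrite /=; ring].
- by eapply is_derive_eq; [repeat derive_rules|rewrite /=; ring].
- by eapply is_derive_eq; [repeat derive_rules|rewrite /=; ring].
- by apply: continuous_pointwise => p; repeat continuous_rules.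
- by apply: continuous_pointwise => p; repeat continuous_rules.
- by apply: continuous_pointwise => p; repeat continuous_rules.
Qed.

Lemma square_test_backward x t v : is_velocity v ->
  backward_residual lambda kappa gamma E square_test square_test_t square_test_x
    (fun _ _ _ => 2) x t v = 0.
Proof.
move=> hv; have v2 : v ^+ 2 = 1 by case: hv => ->; rewrite ?sqrrN expr1n.
rewrite /backward_residual /drift /square_test /square_test_t /square_test_x relaxation_tE.
transitivity (lambda ^+ 2 / gamma * relaxation t * (v ^+ 2 - 1)).
  by field; exact: lt0r_neq0.
by rewrite v2 subrr mulr0.
Qed.

Lemma expectation_polynomial_test phi phi_t phi_x phi_xx f B :
    smooth_test phi phi_t phi_x phi_xx -> continuous f -> 0 <= B ->
    (forall x t v, 0 <= t <= T -> is_velocity v ->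
       `|phi x t v| <= B * (1 + x ^+ 2) /\ `|phi_x x t v| <= B * (1 + x ^+ 2)) ->
    (forall x t v, is_velocity v ->
       backward_residual lambda kappa gamma E phi phi_t phi_x phi_xx x t v = 0) ->
    (forall x v, is_velocity v -> phi x T v = f x) ->
  ('E_P[f \o tp_X Z T] = ((phi 0 0 1 + phi 0 0 (-1)) / 2)%:E)%E.
Proof.
move=> st cf B0 dom bw fin; have [K hK] := quadratic_moment_segment T B0.
apply: (expectation_backward st _ cf T_gt0 dom hK) => //.
- by apply: continuous_pointwise => x; repeat continuous_rules.
- by move=> x t v _; exact: bw.
Qed.

Lemma norm_le_quadratic x : `|x| <= 1 + x ^+ 2.
Proof.
rewrite -(real_normK (num_real x)); move: `|x| => y.
by have := sqr_ge0 (y - 1); nra.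
Qed.

Lemma relaxation_term_le (k v t : R) : t <= T -> is_velocity v ->
  `|k * v * relaxation t| <= `|k|.
Proof.
move=> tT hv; have /andP[m0 m1] := relaxation_bounds tT.
rewrite !normrM (ger0_norm m0); case: hv => ->; rewrite ?normrN normr1 mulr1;
  by rewrite ler_piMr.
Qed.

Lemma mean_telegrapher : ('E_P[tp_X Z T] = (c * T)%:E)%E.
Proof.
pose L := `|lambda / (2 * gamma)|; pose B := 1 + `|c| * T + L.
have cT : 0 <= `|c| * T by rewrite mulr_ge0// ltW.
have L0 : 0 <= L by exact: normr_ge0.
have B0 : 0 <= B by rewrite /B; lra.
have dom x t v : 0 <= t <= T -> is_velocity v ->
    `|mean_test x t v| <= B * (1 + x ^+ 2) /\ `|1 : R| <= B * (1 + x ^+ 2).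
  move=> /andP[t0 tT] hv; have x2 := sqr_ge0 x.
  split; last by rewrite normr1 /B; nra.
  have b1 := norm_le_quadratic x.
  have b2 : `|c * (T - t)| <= `|c| * T.
    by rewrite normrM ler_wpM2l// ger0_norm; lra.
  have b3 := relaxation_term_le (lambda / (2 * gamma)) tT hv.
  rewrite /mean_test (le_trans (ler_normD _ _))//.
  rewrite (le_trans (lerD (ler_normD _ _) (lexx _)))//.
  apply: (@le_trans _ _ (1 + x ^+ 2 + `|c| * T + L)); first exact: lerD (lerD b1 b2) b3.
  by rewrite /B; nra.
have cid : continuous (fun x : R => x) by move=> x; exact: continuous1_id.
have fin x v : is_velocity v -> mean_test x T v = x.
  by move=> _; rewrite /mean_test /relaxation subrr !mulr0 oppr0 expR0 subrr mulr0 !addr0.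
have := expectation_polynomial_test mean_test_smooth cid B0 dom
  (fun x t v _ => mean_test_backward x t v) fin.
rewrite (_ : _ \o _ = tp_X Z T :> (_ -> _)); last exact/funext.
move=> ->; congr EFin; rewrite /mean_test subr0; field; exact: lt0r_neq0.
Qed.

Lemma variance_telegrapher : ('V_P[tp_X Z T] =
  ((2 * kappa + lambda ^+ 2 / gamma) * T
   - lambda ^+ 2 / (2 * gamma ^+ 2) * (1 - expR (- (2 * gamma * T))))%:E)%E.
Proof.
pose M := `|c| * T; pose L := `|lambda / gamma|.
pose D := (2 * kappa + lambda ^+ 2 / gamma) * T; pose N := lambda ^+ 2 / (2 * gamma ^+ 2).
pose B := 4 + 2 * M ^+ 2 + 2 * M + 2 * L + L * M + D + N.
have g0 := ltW gamma_gt0.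
have M0 : 0 <= M by rewrite mulr_ge0// ltW.
have L0 : 0 <= L by exact: normr_ge0.
have rate0 : 0 <= 2 * kappa + lambda ^+ 2 / gamma.
  by rewrite addr_ge0 ?[0 <= _ / _]divr_ge0 ?sqr_ge0// mulr_ge0.
have D0 : 0 <= D by rewrite mulr_ge0// ltW.
have N0 : 0 <= N by rewrite divr_ge0 ?sqr_ge0// mulr_ge0// sqr_ge0.
have LM0 : 0 <= L * M by rewrite mulr_ge0.
have M20 := sqr_ge0 M.
have B0 : 0 <= B by rewrite /B; lra.
have dom x t v : 0 <= t <= T -> is_velocity v ->
    `|square_test x t v| <= B * (1 + x ^+ 2) /\
    `|square_test_x x t v| <= B * (1 + x ^+ 2).
  move=> /andP[t0 tT] hv; have x2 := sqr_ge0 x.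
  have xq := norm_le_quadratic x.
  have /andP[m0 m1] := relaxation_bounds tT.
  have y1 : `|x - c * t| <= `|x| + M.
    rewrite (le_trans (ler_normB _ _))// lerD2l normrM ler_wpM2l// ger0_norm//.
  have y0 := normr_ge0 (x - c * t); have x0 := normr_ge0 x.
  have k1 := relaxation_term_le (lambda / gamma) tT hv.
  have y2 : (x - c * t) ^+ 2 <= 2 * x ^+ 2 + 2 * M ^+ 2.
    rewrite -(real_normK (num_real (x - c * t))) -(real_normK (num_real x)).
    by have := sqr_ge0 (`|x| - M); nra.
  have k2 : `|lambda / gamma * ((x - c * t) * v * relaxation t)| <= L * (`|x| + M).
    rewrite (_ : _ * _ = lambda / gamma * v * relaxation t * (x - c * t)); last by ring.
    by rewrite normrM ler_pM.
  have d1 : 0 <= (2 * kappa + lambda ^+ 2 / gamma) * (T - t) <= D.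
    by rewrite mulr_ge0 ?subr_ge0//= ler_wpM2l//; lra.
  have n1 : 0 <= N * relaxation t <= N by rewrite mulr_ge0//= ler_piMr.
  have base : 0 <= (B - (2 + 2 * M ^+ 2 + 2 * M + L + L * M + D + N)) * x ^+ 2.
    by rewrite mulr_ge0// /B; lra.
  have Lx : L * `|x| <= L * (1 + x ^+ 2) by rewrite ler_wpM2l.
  split; last first.
    rewrite /square_test_x (le_trans (ler_normD _ _))// (le_trans (lerD (lexx _) k1))//.
    rewrite normrM (ger0_norm (ler0n _ _)) -/L.
    have : 0 <= B * x ^+ 2 - 2 * x ^+ 2.
      by rewrite -mulrBl mulr_ge0// /B; lra.
    by rewrite /B; lra.
  rewrite /square_test (le_trans (ler_normD _ _))//.
  have s1 : `|(x - c * t) ^+ 2 + lambda / gamma * ((x - c * t) * v * relaxation t)|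
      <= 2 * x ^+ 2 + 2 * M ^+ 2 + L * (`|x| + M).
    rewrite (le_trans (ler_normD _ _))// lerD// ger0_norm ?sqr_ge0//.
  have s2 : `|(2 * kappa + lambda ^+ 2 / gamma) * (T - t) - N * relaxation t| <= D + N.
    by rewrite ler_norml; move: d1 n1 => /andP[d1 d2] /andP[n1 n2]; apply/andP; split; lra.
  rewrite (le_trans (lerD s1 s2))//.
  move: base Lx; rewrite /B; nra.
have cf : continuous (fun x => (x - c * T) ^+ 2).
  by apply: continuous_pointwise => x; repeat continuous_rules.
have fin x v : is_velocity v -> square_test x T v = (x - c * T) ^+ 2.
  by move=> _; rewrite /square_test /relaxation subrr !mulr0 oppr0 expR0 subrr !mulr0 !addr0 subr0 addr0.
have := expectation_polynomial_test square_test_smooth cf B0 dom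
  (fun x t v hv => square_test_backward x t hv) fin.
rewrite /variance covariance.unlock mean_telegrapher /= => H.
rewrite (_ : _ * _ = (fun x => (x - c * T) ^+ 2) \o tp_X Z T); last first.
  by apply/funext => w /=; rewrite expr2.
rewrite H; congr EFin; rewrite /square_test /relaxation !subr0 !mulr0 subr0.
by field; exact: lt0r_neq0.
Qed.

End MeanVariance.

End ExactLaws.

(** * Long-time limits *)

Section Limits.
Context {R : realType}.
Variables lambda kappa gamma E : R.
Hypothesis kappa_ge0 : 0 <= kappa.
Hypothesis gamma_gt0 : 0 < gamma.
Variable Z : telegrapher lambda kappa gamma E.
Implicit Types a t x : R.

Lemma inv_cvg0 : t^-1 @[t --> +oo] --> (0 : R).
Proof.
apply/cvgrPdist_lt => e e0; near=> t.
have t0 : 0 < t by near: t; exact: nbhs_pinfty_gt.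
rewrite sub0r normrN gtr0_norm ?invr_gt0// invf_plt ?posrE//.
by near: t; apply: nbhs_pinfty_gt; rewrite num_real.
Unshelve. all: by end_near. Qed.

Definition free_energy_formula a : R :=
  a ^+ 2 * kappa + 2 * a * kappa * E
  + Num.sqrt (lambda ^+ 2 * a ^+ 2 + gamma ^+ 2) - gamma.

(** The moment generating function is a convex combination of two exponentials
    in which the larger one has weight at least 1/2. *)
Lemma log_mgf_cvg a :
  log_mgf_rate Z a t @[t --> +oo] --> (free_energy_formula a)%:E.
Proof.
set s := mgf_root lambda gamma a; pose th := mgf_exponent lambda kappa gamma E a.
have s0 : 0 < s by exact: mgf_root_gt0.
have thE : th 1 = free_energy_formula a.
  by rewrite /th /mgf_exponent /free_energy_formula /mgf_root; ring.
have gs : 0 < gamma / s <= 1.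
  rewrite divr_gt0//= ler_pdivrMr// mul1r -(ger0_norm (ltW gamma_gt0)) -sqrtr_sqr.
  by rewrite ler_wsqrtr// lerDr mulr_ge0 ?sqr_ge0.
pose m t := ((1 + gamma / s) * expR (th 1 * t) + (1 - gamma / s) * expR (th (-1) * t)) / 2.
have mE t : 0 < t -> ('M_(tp_prob Z) (tp_X Z t) a = (m t)%:E)%E.
  by move=> t0; rewrite (mgf_telegrapher kappa_ge0 gamma_gt0 Z a t0).
have m_bounds t : 0 < t -> expR (th 1 * t) / 2 <= m t <= expR (th 1 * t).
  move=> t0; have e1 := expR_gt0 (th 1 * t); have e2 := expR_gt0 (th (-1) * t).
  have e12 : expR (th (-1) * t) <= expR (th 1 * t).
    rewrite ler_expR ler_wpM2r ?(ltW t0)// /th /mgf_exponent lerD2l -/s; lra.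
  move: gs => /andP[g0 g1]; rewrite /m; move: (gamma / s) g0 g1 => w g0 g1.
  by apply/andP; split; nra.
have m0 t : 0 < t -> 0 < m t.
  by move=> t0; have /andP[+ _] := m_bounds t t0; apply: lt_le_trans; rewrite divr_gt0 ?expR_gt0.
have ln_bounds t : 0 < t -> th 1 - t^-1 * ln 2 <= t^-1 * ln (m t) <= th 1.
  move=> t0; have /andP[b1 b2] := m_bounds t t0; have mp := m0 t t0.
  have h1 : th 1 * t - ln 2 <= ln (m t).
    rewrite -[th 1 * t]expRK -lnV ?posrE// -lnM ?posrE ?invr_gt0 ?expR_gt0//.
    by rewrite ler_ln// ?posrE//; apply: divr_gt0; rewrite ?expR_gt0.
  have h2 : ln (m t) <= th 1 * t.
    by rewrite -[leRHS]expRK ler_ln// posrE expR_gt0.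
  rewrite [t^-1 * ln (m t)]mulrC [t^-1 * ln 2]mulrC.
  by rewrite ler_pdivlMr// ler_pdivrMr// h2 andbT mulrBl divfK// gt_eqF.
rewrite -thE; apply: (@cvg_trans _ ((t^-1 * ln (m t))%:E @[t --> +oo])).
  apply: near_eq_cvg; near=> t; have t0 : 0 < t by near: t; exact: nbhs_pinfty_gt.
  by rewrite /log_mgf_rate mE// lne_EFin ?m0.
apply: cvg_EFin; first exact: nearW.
apply: (@squeeze_cvgr _ _ _ _ (fun t => th 1 - t^-1 * ln 2) (cst (th 1))).
- near=> t; apply: ln_bounds; by near: t; exact: nbhs_pinfty_gt.
- rewrite -[X in _ --> X]subr0; apply: cvgB; first exact: cvg_cst.
  rewrite -[X in _ --> X](mul0r (ln 2)); apply: cvgM; first exact: inv_cvg0.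
  exact: cvg_cst.
- exact: cvg_cst.
Unshelve. all: by end_near. Qed.

Lemma free_energyE a : free_energy Z a = free_energy_formula a.
Proof. by rewrite /free_energy (cvg_lim _ (@log_mgf_cvg a)). Qed.

Lemma mean_rate_cvg : mean_rate Z t @[t --> +oo] --> (2 * kappa * E)%:E.
Proof.
apply: cvg_near_cst; near=> t.
have t0 : 0 < t by near: t; exact: nbhs_pinfty_gt.
rewrite /mean_rate (mean_telegrapher kappa_ge0 gamma_gt0 Z t0) -EFinM; congr EFin.
by rewrite mulrC mulfK// gt_eqF.
Unshelve. all: by end_near. Qed.

Lemma variance_rate_cvg :
  variance_rate Z t @[t --> +oo] --> (2 * kappa + lambda ^+ 2 / gamma)%:E.
Proof.
set D := _ + _ / _; pose N := lambda ^+ 2 / (2 * gamma ^+ 2).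
pose w t := D - t^-1 * (N * (1 - expR (- (2 * gamma * t)))).
have N0 : 0 <= N by rewrite divr_ge0 ?sqr_ge0// mulr_ge0// sqr_ge0.
apply: (@cvg_trans _ ((w t)%:E @[t --> +oo])).
  apply: near_eq_cvg; near=> t; have t0 : 0 < t by near: t; exact: nbhs_pinfty_gt.
  rewrite /variance_rate (variance_telegrapher kappa_ge0 gamma_gt0 Z t0) -EFinM.
  by congr EFin; rewrite /w -/D -/N [RHS]mulrBr [t^-1 * (D * t)]mulrC mulfK// gt_eqF.
apply: cvg_EFin; first exact: nearW.
apply: (@squeeze_cvgr _ _ _ _ (fun t => D - t^-1 * N) (cst D)).
- near=> t; have t0 : 0 < t by near: t; exact: nbhs_pinfty_gt.
  have e1 : expR (- (2 * gamma * t)) <= 1.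
    by rewrite -[leRHS]expR0 ler_expR oppr_le0 !mulr_ge0// ltW.
  have e0 := expR_gt0 (- (2 * gamma * t)).
  have ti : 0 <= t^-1 by rewrite invr_ge0 ltW.
  rewrite /w /= lerB//=; last by rewrite ler_wpM2l// ler_piMr//; lra.
  by rewrite lerBlDr lerDl mulr_ge0// mulr_ge0// subr_ge0.
- rewrite -[X in _ --> X]subr0; apply: cvgB; first exact: cvg_cst.
  rewrite -[X in _ --> X](mul0r N); apply: cvgM; first exact: inv_cvg0.
  exact: cvg_cst.
- exact: cvg_cst.
Unshelve. all: by end_near. Qed.

Definition free_energy_derivative a : R :=
  2 * a * kappa + 2 * kappa * E
  + lambda ^+ 2 * a / Num.sqrt (lambda ^+ 2 * a ^+ 2 + gamma ^+ 2).

Lemma is_derive_root a :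
  is_derive a 1 (fun a => Num.sqrt (lambda ^+ 2 * a ^+ 2 + gamma ^+ 2))
   (lambda ^+ 2 * a / Num.sqrt (lambda ^+ 2 * a ^+ 2 + gamma ^+ 2)).
Proof.
have D : is_derive a 1 (fun a => lambda ^+ 2 * a ^+ 2 + gamma ^+ 2) (lambda ^+ 2 * (2 * a)).
  by eapply is_derive_eq; [repeat derive_rules|rewrite /=; ring].
have u0 : 0 < lambda ^+ 2 * a ^+ 2 + gamma ^+ 2.
  by rewrite ltr_wpDl ?exprn_gt0// mulr_ge0 ?sqr_ge0.
have H := @is_derive1_comp _ Num.sqrt
  (fun a => lambda ^+ 2 * a ^+ 2 + gamma ^+ 2) _ _ _ (is_derive1_sqrt u0) D.
eapply is_derive_eq; first exact: H.
by field; rewrite gt_eqF// sqrtr_gt0.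
Qed.

Lemma is_derive_free_energy a :
  is_derive a 1 free_energy_formula (free_energy_derivative a).
Proof.
rewrite /free_energy_formula; eapply is_derive_eq.
  by repeat first [exact (is_derive_root a) | derive_rules].
by rewrite /free_energy_derivative /=; ring.
Qed.

Lemma is_derive_free_energy2 :
  is_derive (0 : R) 1 free_energy_derivative (2 * kappa + lambda ^+ 2 / gamma).
Proof.
have r0 : Num.sqrt (lambda ^+ 2 * 0 ^+ 2 + gamma ^+ 2) = gamma.
  by rewrite expr0n mulr0 add0r sqrtr_sqr gtr0_norm.
have nz : Num.sqrt (lambda ^+ 2 * 0 ^+ 2 + gamma ^+ 2) != 0 by rewrite r0 gt_eqF.
have dinv := @is_derive1_inv _
  (fun a => Num.sqrt (lambda ^+ 2 * a ^+ 2 + gamma ^+ 2)) _ _ nz (is_derive_root 0).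
rewrite /free_energy_derivative; eapply is_derive_eq.
  by repeat first [exact dinv | derive_rules].
by rewrite /= r0; field; exact: lt0r_neq0.
Qed.

Lemma asymptotic_velocityE : asymptotic_velocity Z = 2 * kappa * E.
Proof. by rewrite /asymptotic_velocity (cvg_lim _ (@mean_rate_cvg)). Qed.

Lemma diffusion_constantE : diffusion_constant Z = 2 * kappa + lambda ^+ 2 / gamma.
Proof. by rewrite /diffusion_constant (cvg_lim _ (@variance_rate_cvg)). Qed.

End Limits.

End Telegraph.

Theorem mainTheorem5 (R : realType) (lambda kappa gamma : R)
    (kappa_ge0 : 0 <= kappa) (gamma_gt0 : 0 < gamma) :
  (forall (E : R) (Z : telegrapher lambda kappa gamma E),
    let F := free_energy Z in
    [/\ forall a : R,
          log_mgf_rate Z a t @[t --> +oo] --> (F a)%:E /\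
          F a = a ^+ 2 * kappa + 2 * a * kappa * E
                + Num.sqrt (lambda ^+ 2 * a ^+ 2 + gamma ^+ 2) - gamma,
        [/\ forall a : R, derivable F a 1,
            mean_rate Z t @[t --> +oo] --> (derive1 F 0)%:E &
            derive1 F 0 = 2 * kappa * E],
        [/\ derivable (derive1 F) 0 1,
            variance_rate Z t @[t --> +oo] --> (derive1n 2 F 0)%:E &
            derive1n 2 F 0 = 2 * kappa + lambda ^+ 2 / gamma] &
        E * diffusion_constant Z - asymptotic_velocity Z
          = E * (lambda ^+ 2 / gamma) /\
        (lambda != 0 -> E != 0 ->
          asymptotic_velocity Z != E * diffusion_constant Z)]) /\
  (forall Z : forall E : R, telegrapher lambda kappa gamma E,
    let V := fun E => asymptotic_velocity (Z E) in
    let D := fun E => diffusion_constant (Z E) in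
    [/\ forall E, D E = D 0,
        derivable V 0 1,
        D 0 - derive1 V 0 = lambda ^+ 2 / gamma &
        lambda != 0 -> ~ einstein_relation V D]).
Proof.
have drift_ne0 : lambda != 0 -> lambda ^+ 2 / gamma != 0.
  by move=> l0; rewrite mulf_neq0 ?expf_neq0// invr_eq0 gt_eqF.
split=> [E Z F|Z V D].
  have FE : F = free_energy_formula lambda kappa gamma E.
    by apply/funext => a; exact: free_energyE.
  have dF a : derive1 F a = free_energy_derivative lambda kappa gamma E a.
    by rewrite derive1E FE; case: (is_derive_free_energy lambda kappa E gamma_gt0 a).
  have dF' : derive1 F = free_energy_derivative lambda kappa gamma E by exact/funext.
  have dF0 : derive1 F 0 = 2 * kappa * E.
    by rewrite dF /free_energy_derivative !(mulr0, mul0r) add0r addr0.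
  have [d2 d2E] := is_derive_free_energy2 lambda kappa E gamma_gt0.
  have d2F : derive1n 2 F 0 = 2 * kappa + lambda ^+ 2 / gamma.
    by rewrite derive1nS derive1n1 dF' derive1E.
  split.
  - by move=> a; rewrite FE; split; [exact: log_mgf_cvg|].
  - split; [|by rewrite dF0; exact: mean_rate_cvg|by []].
    by move=> a; rewrite FE; case: (is_derive_free_energy lambda kappa E gamma_gt0 a).
  - split; [by rewrite dF'|by rewrite d2F; exact: variance_rate_cvg|by []].
  - rewrite asymptotic_velocityE// diffusion_constantE//; split; first by ring.
    move=> l0 E0; rewrite -subr_eq0 (_ : _ - _ = - (E * (lambda ^+ 2 / gamma))).
      by rewrite oppr_eq0 mulf_neq0// drift_ne0.
    by ring.
have VE : V = (fun E => 2 * kappa * E).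
  by apply/funext => E; exact: asymptotic_velocityE.
have DE E : D E = 2 * kappa + lambda ^+ 2 / gamma by exact: diffusion_constantE.
have dV : is_derive (0 : R) 1 V (2 * kappa).
  rewrite VE; eapply is_derive_eq; first exact: (is_derive1_mul (is_derive1_cst _ _) (is_derive1_id _)).
  by rewrite /=; ring.
have V0 : derive1 V 0 = 2 * kappa by rewrite derive1E; case: dV.
split.
- by move=> E; rewrite !DE.
- by case: dV.
- by rewrite DE V0; ring.
- move=> /drift_ne0 l0 [_]; rewrite V0 DE => /eqP; rewrite -subr_eq0 opprD addrA subrr add0r oppr_eq0.
  by rewrite (negbTE l0).
Qed.
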